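(* Timeline Partial Dominating Set can be solved in $2^{\mathcal{O}(t)}\cdot (n+T)^{\mathcal{O}(1)}$ time, where $n=|V|$.
   Context: A temporal graph $\mathcal{G}=(G_1,\dots,G_T)$ is a finite sequence of simple undirected graphs (snapshots) on a common finite vertex set $V$, $n=|V|$. A temporal vertex is a pair $(v,i)$. An activity interval is a triple $(v,a,b)$ with $v\in V$, $1\le a\le b\le T$; its length is $b-a$. A $k$-activity $\ell$-timeline is a set of activity intervals with at most $k$ intervals per vertex, each of length at most $\ell$. A vertex $v$ is active at time $i$ if some $(v,a,b)$ in the timeline has $a\le i\le b$; the timeline dominates $(v,i)$ if $v\in N_{G_i}[u]$ for some $u$ active at time $i$. Timeline Partial Dominating Set: given $\mathcal{G}$ and integers $k\ge1,\ell\ge0,t\ge0$, decide whether some $k$-activity $\ell$-timeline dominates at least $t$ temporal vertices. *)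

(* Defs.v *)
From mathcomp Require Import all_boot.

Set Implicit Arguments.
Unset Strict Implicit.
Unset Printing Implicit Defensive.

Record sgraph (V : finType) := SGraph {
  adj : rel V;
  adj_sym : symmetric adj;
  adj_irrefl : irreflexive adj
}.

Definition closed_nbh (V : finType) (g : sgraph V) (u : V) : {set V} :=
  [set v | (v == u) || adj g u v].

(* The times 1, ..., T are numbered 0, ..., T - 1 here. *)
Definition temporal_graph (V : finType) (T : nat) := T.-tuple (sgraph V).

Section Timelines.

Variables (V : finType) (T : nat).

(* ((v, a), b) stands for (v, a, b); that a <= b holds is part of
   [is_timeline]. *)
Local Notation interval := (V * 'I_T * 'I_T)%type.

Definition ivertex (x : interval) : V := x.1.1.
Definition istart (x : interval) : 'I_T := x.1.2.
Definition iend (x : interval) : 'I_T := x.2.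

Definition is_timeline (k l : nat) (S : {set interval}) : bool :=
  [forall x in S, (istart x <= iend x) && (iend x - istart x <= l)] &&
  [forall v : V, #|[set x in S | ivertex x == v]| <= k].

Definition active (S : {set interval}) (v : V) (i : 'I_T) : bool :=
  [exists x in S, [&& ivertex x == v, istart x <= i & i <= iend x]].

Definition dominates (G : temporal_graph V T) (S : {set interval})
    (v : V) (i : 'I_T) : bool :=
  [exists u : V, active S u i && (v \in closed_nbh (tnth G i) u)].

Definition dominated (G : temporal_graph V T) (S : {set interval}) :
    {set V * 'I_T} :=
  [set p | dominates G S p.1 p.2].

Definition timeline_partial_dominating_set (G : temporal_graph V T)
    (k l t : nat) : bool :=
  [exists S : {set interval},
     is_timeline k l S && (t <= #|dominated G S|)].

(* Vertices are numbered in the order of [enum V]; the entry for the pair of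
   vertices numbered u, v at time i (all from 0) is at position
   5 + (i * #|V| + u) * #|V| + v. *)
Definition encode (G : temporal_graph V T) (k l t : nat) : seq nat :=
  [:: #|V|; T; k; l; t] ++
  flatten [seq [seq (adj g u v : nat) | u <- enum V, v <- enum V]
          | g <- val G].

End Timelines.

(* A random access machine with unit-cost instructions: registers R[0], R[1],
   ... hold natural numbers and are 0 initially; the input is a read-only array
   of natural numbers.  The arithmetic is addition and truncated subtraction
   only: unit-cost multiplication would make the model unreasonably strong. *)
Inductive instr :=
| Const of nat & nat        (* Const x c   : R[x] := c           *)
| Add of nat & nat & nat    (* Add x y z   : R[x] := R[y] + R[z] *)
| Sub of nat & nat & nat    (* Sub x y z   : R[x] := R[y] - R[z] *)
| Fetch of nat & nat        (* Fetch x y   : R[x] := R[R[y]]     *)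
| Store of nat & nat        (* Store x y   : R[R[x]] := R[y]     *)
| Read of nat & nat         (* Read x y    : R[x] := input[R[y]], 0 past the end *)
| Jumpz of nat & nat        (* Jumpz x p   : if R[x] = 0, go to instruction p *)
| Accept
| Reject.

Definition program := seq instr.

Definition memory := nat -> nat.

Definition upd (R : memory) (x a : nat) : memory :=
  fun y => if y == x then a else R y.

(* [exec P input s pc R] is [Some b] when P, started at instruction pc with
   register contents R, halts with answer b after executing at most s
   instructions.  Leaving the program text gives no answer. *)
Fixpoint exec (P : program) (input : seq nat) (s pc : nat) (R : memory) :
    option bool :=
  if s isn't s'.+1 then None else
  match onth P pc with
  | None => None
  | Some (Const x c) => exec P input s' pc.+1 (upd R x c)
  | Some (Add x y z) => exec P input s' pc.+1 (upd R x (R y + R z))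
  | Some (Sub x y z) => exec P input s' pc.+1 (upd R x (R y - R z))
  | Some (Fetch x y) => exec P input s' pc.+1 (upd R x (R (R y)))
  | Some (Store x y) => exec P input s' pc.+1 (upd R (R x) (R y))
  | Some (Read x y) => exec P input s' pc.+1 (upd R x (nth 0 input (R y)))
  | Some (Jumpz x p) => exec P input s' (if R x == 0 then p else pc.+1) R
  | Some Accept => Some true
  | Some Reject => Some false
  end.

Definition answers_within (P : program) (input : seq nat) (s : nat)
    (b : bool) : Prop :=
  exec P input s 0 (fun _ => 0) = Some b.

(* Main.v *)
Require Import Defs.
From mathcomp Require Import all_boot zify.

(* Put L = l + 1 and K = k L.  Left to itself, a vertex can be active for
   min(K, T) time steps and dominates itself then, so the answer is yes when
   t <= n min(K, T), and no when t > n T.  Otherwise n K < t.  Give every vertex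
   K units of fuel, one unit being burnt per active time step: when L divides
   the remaining fuel the vertex may rest or start a new interval, otherwise it
   is in the middle of an interval and has to stay active.  There are
   (K + 1)^n <= 2^(n K) <= 2^t fuel vectors, so a dynamic program over time,
   whose states are the fuel vectors read as numbers in base K + 1, is fast
   enough.  It is written in a language of bounded loops; no loop makes more
   than M = (n + T + 1)^2 2^t rounds, hence the compiled code stops within a
   number of steps that is polynomial in M. *)

Set Implicit Arguments.
Unset Strict Implicit.
Unset Printing Implicit Defensive.

(** * Dynamic programming over a chain of moves *)

Section ChainValue.

Variables (legal : rel nat) (gain : nat -> nat -> nat) (T : nat).

(* The best total gain of the last j of T time steps from state f, a legal move
   e leading to state f - e. *)
Fixpoint value (j f : nat) : nat :=
  if j is j'.+1 then
    \max_(e < f.+1 | legal f e) (gain (T - j) e + value j' (f - e))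
  else 0.

Definition is_path (m : nat) (F es : nat -> nat) : Prop :=
  forall i, m <= i < T ->
  [/\ legal (F i) (es i), es i <= F i & F i.+1 = F i - es i].

Lemma path_le_value F es :
  is_path 0 F es -> \sum_(0 <= i < T) gain i (es i) <= value T (F 0).
Proof.
move=> path; suff tail_le j : j <= T ->
    \sum_(T - j <= i < T) gain i (es i) <= value j (F (T - j)).
  by have := tail_le T (leqnn T); rewrite subnn.
elim: j => [_|j IH jT]; first by rewrite subn0 big_geq.
have [|legal_e le_e FS] := path (T - j.+1); first by lia.
have TjS : T - j = (T - j.+1).+1 by lia.
rewrite big_ltn; last by lia.
apply: leq_trans (leq_bigmax_cond (Ordinal (le_e : _ < _.+1)) legal_e).
by rewrite /= leq_add2l -FS -TjS IH // ltnW.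
Qed.

Variable nstates : nat.
Hypothesis legal_ex : forall f, f < nstates -> exists2 e, e <= f & legal f e.

Lemma value_path j f : j <= T -> f < nstates ->
  exists F es, [/\ F (T - j) = f, is_path (T - j) F es &
    value j f = \sum_(T - j <= i < T) gain i (es i)].
Proof.
elim: j f => [|j IH] f jT fb.
  exists (fun=> f), (fun=> 0); split=> //; first by move=> i; lia.
  by rewrite subn0 big_geq.
have [e0 ef0 lg0] := legal_ex fb.
have [|e lg valueE] := @eq_bigmax_cond _ (fun x : 'I_f.+1 => legal f x)
  (fun x : 'I_f.+1 => gain (T - j.+1) x + value j (f - x)).
  by apply/card_gt0P; exists (Ordinal (ef0 : e0 < f.+1)).
have [||F [es [F0 path sumE]]] := IH (f - e).
- exact: ltnW.
- exact: leq_ltn_trans (leq_subr _ _) fb.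
have TjS : T - j = (T - j.+1).+1 by lia.
exists (fun i => if i == T - j.+1 then f else F i),
  (fun i => if i == T - j.+1 then val e else es i).
split; first by rewrite eqxx.
  move=> i /andP[le_i iT]; case: eqP => [->|ne].
    by rewrite gtn_eqF // -TjS F0; split=> //; apply: (ltn_ord e).
  by rewrite ifF; [apply: path; lia | lia].
rewrite big_ltn ?eqxx; last by lia.
rewrite [LHS]valueE sumE -TjS; congr (_ + _); apply: eq_big_nat => i hi.
by rewrite ifF //; lia.
Qed.

End ChainValue.

(** * States as numbers in base B *)

Definition digit (B f u : nat) : nat := f %/ B ^ u %% B.

Definition of_digits (B n : nat) (d : 'I_n -> nat) : nat :=
  \sum_(u < n) d u * B ^ u.

(* Digit u of f is the fuel left to vertex u, and digit u of the move e is the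
   fuel that u burns in one time step. *)
Definition legal (n B L f e : nat) : bool :=
  [forall u : 'I_n, [&& digit B e u <= 1, digit B e u <= digit B f u &
    (digit B e u != 0) || (L %| digit B f u)]].

Section Digits.

Variable B : nat.
Hypothesis B0 : 0 < B.

Lemma of_digits_recl n (d : 'I_n.+1 -> nat) :
  of_digits B d = d ord0 + B * of_digits B (fun u => d (lift ord0 u)).
Proof.
rewrite /of_digits big_ord_recl muln1 big_distrr; congr (_ + _).
by apply: eq_bigr => u _; rewrite /= /bump /= expnS mulnCA.
Qed.

Lemma digit_lt f u : digit B f u < B.
Proof. exact: ltn_pmod. Qed.

Lemma digitS f u : digit B f u.+1 = digit B (f %/ B) u.
Proof. by rewrite /digit expnS divnMA. Qed.

Lemma digit_of_digits n (d : 'I_n -> nat) (v : 'I_n) :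
  (forall u, d u < B) -> digit B (of_digits B d) v = d v.
Proof.
elim: n d v => [|n IH] d v dB; first by case: v.
rewrite of_digits_recl mulnC addnC; case: (unliftP ord0 v) => [u|] ->.
  by rewrite digitS divnMDl // divn_small // addn0 IH.
by rewrite /digit divn1 modnMDl modn_small.
Qed.

Lemma of_digits_digit n f :
  f < B ^ n -> of_digits B (fun u : 'I_n => digit B f u) = f.
Proof.
elim: n f => [|n IH] f fB; first by rewrite /of_digits big_ord0; lia.
rewrite of_digits_recl {1}/digit divn1.
have -> : of_digits B (fun u : 'I_n => digit B f (lift ord0 u)) =
          of_digits B (fun u : 'I_n => digit B (f %/ B) u).
  by apply: eq_bigr => u _; rewrite -digitS.
by rewrite IH ?ltn_divLR -?expnSr // addnC mulnC -divn_eq.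
Qed.

Lemma of_digits_max n : of_digits B (fun _ : 'I_n => B.-1) = B ^ n - 1.
Proof.
elim: n => [|n IH]; first by rewrite /of_digits big_ord0.
have Bn0 : 0 < B ^ n by rewrite expn_gt0 B0.
by rewrite of_digits_recl IH expnS; nia.
Qed.

Lemma leq_of_digits n (d d' : 'I_n -> nat) :
  (forall u, d u <= d' u) -> of_digits B d <= of_digits B d'.
Proof. by move=> h; apply: leq_sum => u _; rewrite leq_mul2r h orbT. Qed.

Lemma of_digits_sub n (d d' : 'I_n -> nat) : (forall u, d' u <= d u) ->
  of_digits B (fun u => d u - d' u) = of_digits B d - of_digits B d'.
Proof.
move=> h; rewrite [of_digits B d](_ : _ =
  of_digits B (fun u => d u - d' u) + of_digits B d') ?addnK //.
rewrite /of_digits -big_split; apply: eq_bigr => u _ /=.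
by rewrite -mulnDl subnK.
Qed.

Lemma digit_sub n f e (u : 'I_n) : f < B ^ n -> e < B ^ n ->
  (forall v : 'I_n, digit B e v <= digit B f v) ->
  digit B (f - e) u = digit B f u - digit B e u.
Proof.
move=> fB eB h; rewrite -{1}(of_digits_digit fB) -{1}(of_digits_digit eB).
rewrite -of_digits_sub // digit_of_digits // => v.
exact: leq_ltn_trans (leq_subr _ _) (digit_lt _ _).
Qed.

Lemma legalP n L f e :
  reflect (forall u : 'I_n, [/\ digit B e u <= 1, digit B e u <= digit B f u &
             digit B e u = 0 -> L %| digit B f u])
          (legal n B L f e).
Proof.
apply: (iffP forallP) => h u; have := h u.
  by case/and3P=> e1 ef e0; split=> // eu0; rewrite eu0 in e0.
by case=> -> -> e0 /=; case: eqP => [/e0|].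
Qed.

Lemma legal_exists n L f :
  f < B ^ n -> exists2 e, e <= f & legal n B L f e.
Proof.
move=> fB; pose d (u : 'I_n) : nat := digit B f u != 0.
have d_le u : d u <= digit B f u by rewrite /d; case: (digit B f u).
have dB u : d u < B by apply: leq_ltn_trans (d_le u) (digit_lt f u).
exists (of_digits B d).
  by rewrite -[X in _ <= X](of_digits_digit fB) leq_of_digits.
apply/legalP => u; rewrite digit_of_digits // d_le leq_b1; split=> //.
by rewrite /d; case: (digit B f u).
Qed.

End Digits.

(** * Fuel *)

Section Runs.

Variable L : nat.
Hypothesis L0 : 0 < L.

Definition is_run (T : nat) (fuel : nat -> nat) (act : nat -> bool) : Prop :=
  forall i, i < T -> [/\ act i -> 0 < fuel i, ~~ act i -> L %| fuel i &
                         fuel i.+1 = fuel i - act i].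

Definition starts (fuel : nat -> nat) (act : nat -> bool) (i : nat) : bool :=
  act i && (L %| fuel i).

Lemma divmod_pred_dvdn f : 0 < f -> L %| f ->
  f %/ L = (f.-1 %/ L).+1 /\ (f.-1 %% L).+1 = L.
Proof.
move=> f0 /dvdnP[[|q] fE]; first by lia.
have -> : f.-1 = q * L + L.-1 by rewrite fE mulSn; lia.
rewrite fE mulnK // divnMDl // modnMDl divn_small ?prednK //.
by rewrite modn_small ?addn0 prednK.
Qed.

Lemma divmod_pred_ndvdn f : ~~ (L %| f) ->
  f.-1 %/ L = f %/ L /\ (f.-1 %% L).+1 = f %% L.
Proof.
rewrite /dvdn -lt0n => r0; have rL := ltn_pmod f L0.
have fE : f.-1 = f %/ L * L + (f %% L).-1.
  by rewrite {1}(divn_eq f L) -!subn1 addnBA.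
have lt_rL : (f %% L).-1 < L by lia.
rewrite fE divnMDl // modnMDl (divn_small lt_rL) (modn_small lt_rL).
by rewrite addn0 prednK.
Qed.

Section Run.

Variables (T k : nat) (fuel : nat -> nat) (act : nat -> bool).
Hypotheses (run : is_run T fuel act) (fuel0 : fuel 0 = k * L).

Lemma run_starts_le : \sum_(a < T) starts fuel act a <= k.
Proof.
suff starts_fuel_le j :
    j <= T -> \sum_(a < j) starts fuel act a + fuel j %/ L <= k.
  by apply: leq_trans (starts_fuel_le T (leqnn T)); apply: leq_addr.
elim: j => [_|j IH jT]; first by rewrite big_ord0 fuel0 mulnK.
rewrite big_ord_recr /=; have [pos _ ->] := run jT.
apply: leq_trans (IH (ltnW jT)); rewrite -addnA leq_add2l /starts.
case: (act j) pos => /= [/(_ isT) f0|_]; last by rewrite subn0.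
rewrite subn1; case: (boolP (L %| _)) => d.
  by have [-> _] := divmod_pred_dvdn f0 d; rewrite add1n.
by have [-> _] := divmod_pred_ndvdn d.
Qed.

Lemma run_interrupted_start j : j <= T -> ~~ (L %| fuel j) ->
  exists a, [/\ a < j, j + fuel j %% L = a + L & starts fuel act a].
Proof.
elim: j => [_|j IH jT]; first by rewrite fuel0 dvdn_mull.
have [pos rest ->] := run jT.
case: (boolP (act j)) => aj; last by rewrite subn0 rest.
rewrite subn1; case: (boolP (L %| fuel j)) => d _.
  have [_ m] := divmod_pred_dvdn (pos aj) d.
  by exists j; rewrite /starts aj d; split=> //; rewrite -{2}m; lia.
have [a [lt_aj e s]] := IH (ltnW jT) d; have [_ m] := divmod_pred_ndvdn d.
by exists a; split=> //; lia.
Qed.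

Lemma run_active_start i : i < T -> act i ->
  exists a, [/\ a <= i, i < a + L & starts fuel act a].
Proof.
move=> iT ai; case: (boolP (L %| fuel i)) => d.
  by exists i; rewrite /starts ai d; split=> //; lia.
have [a [lt_ai e s]] := run_interrupted_start (ltnW iT) d.
by move: d; rewrite /dvdn -lt0n => r0; exists a; split=> //; lia.
Qed.

End Run.
End Runs.

(** * Timelines and schedules *)

Lemma sum_ltn_ord (m q : nat) : \sum_(i < m) (i < q) = minn q m.
Proof. by elim: m => [|m IH]; rewrite ?big_ord0 ?big_ord_recr /= ?IH; lia. Qed.

Section Schedules.

Variables (V : finType) (T : nat).
Local Notation interval := (V * 'I_T * 'I_T)%type.
Implicit Types (k l : nat) (S : {set interval}).

Definition schedule k l (fuel : V -> nat -> nat) (act : V -> nat -> bool) :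
    Prop :=
  forall v, is_run l.+1 T (fuel v) (act v) /\ fuel v 0 = k * l.+1.

Lemma schedule_act_le k l fuel act v i :
  schedule k l fuel act -> i < T -> act v i <= fuel v i.
Proof. by case/(_ v)=> run _ /run[pos _ _]; case: (act v i) pos => // ->. Qed.

Lemma schedule_fuel_le k l fuel act v i :
  schedule k l fuel act -> i <= T -> fuel v i <= k * l.+1.
Proof.
case/(_ v)=> run fuel0; elim: i => [|i IH] iT; first by rewrite fuel0.
by have [_ _ ->] := run i iT; apply: leq_trans (leq_subr _ _) (IH (ltnW iT)).
Qed.

Lemma timeline_of_schedule k l fuel act : schedule k l fuel act ->
  exists2 S, is_timeline k l S & forall v (i : 'I_T), act v i -> active S v i.
Proof.
move=> sch; pose S := [set x : interval |
  starts l.+1 (fuel (ivertex x)) (act (ivertex x)) (istart x) &&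
  (iend x == minn (istart x + l) T.-1 :> nat)].
exists S; last first.
  move=> v i act_i; have [run fuel0] := sch v.
  have [a [le_ai lt_i st]] :=
    run_active_start (ltn0Sn l) run fuel0 (ltn_ord i) act_i.
  have aT : a < T by apply: leq_ltn_trans (ltn_ord i).
  have bT : minn (a + l) T.-1 < T by have := ltn_ord i; lia.
  apply/existsP; exists (v, Ordinal aT, Ordinal bT).
  rewrite inE /ivertex /istart /iend /= st !eqxx le_ai /=.
  by have := ltn_ord i; lia.
apply/andP; split.
  apply/forall_inP => x; rewrite inE => /andP[_ /eqP ->].
  by have := ltn_ord (istart x); lia.
apply/forallP => v; have [run fuel0] := sch v.
apply: leq_trans (run_starts_le (ltn0Sn l) run fuel0).
rewrite -(big_mkcond (fun a : 'I_T => starts _ (fuel v) (act v) a) (fun=> 1)).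
rewrite sum1_card; set A := [set x in S | _].
have start_inj : {in A &, injective (@istart V T)}.
  move=> [[v1 a1] b1] [[v2 a2] b2]; rewrite !inE /ivertex /istart /iend /=.
  move=> /andP[/andP[_ /eqP b1E] /eqP v1E] /andP[/andP[_ /eqP b2E] /eqP v2E] aE.
  by subst; congr (_, _); apply: val_inj; rewrite /= b1E b2E.
rewrite -(card_in_imset start_inj); apply: subset_leq_card.
apply/subsetP => _ /imsetP[x + ->].
by rewrite !inE => /andP[/andP[st _] /eqP <-].
Qed.

(* The greedy run follows the timeline: it starts an interval whenever the
   timeline is active and no interval is in progress. *)
Section Greedy.

Variables (k l : nat) (S : {set interval}) (v : V).
Hypothesis tl : is_timeline k l S.

Definition active_at (i : nat) : bool :=
  [exists x in S, [&& ivertex x == v, istart x <= i & i <= iend x]].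

Definition greedy_act (f i : nat) : bool :=
  ~~ (l.+1 %| f) || (active_at i && (0 < f)).

Fixpoint greedy_fuel (i : nat) : nat :=
  if i is i'.+1 then greedy_fuel i' - greedy_act (greedy_fuel i') i'
  else k * l.+1.

Lemma greedy_run :
  is_run l.+1 T greedy_fuel (fun i => greedy_act (greedy_fuel i) i).
Proof.
move=> i _; rewrite /greedy_act; split=> //.
- by case/orP => [|/andP[]] //; case: (greedy_fuel i).
- by rewrite negb_or negbK => /andP[].
Qed.

Definition unfinished (i : nat) : {set interval} :=
  [set x in S | (ivertex x == v) && (i <= iend x)].

Lemma unfinishedS i j : i <= j -> unfinished j \subset unfinished i.
Proof.
move=> ij; apply/subsetP => x; rewrite !inE => /andP[-> /andP[-> jx]] /=.
exact: leq_trans jx.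
Qed.

Lemma active_at_unfinished i : active_at i -> 0 < #|unfinished i|.
Proof.
case/existsP => x /andP[xS /and3P[xv _ ix]].
by apply/card_gt0P; exists x; rewrite inE xS xv.
Qed.

Lemma card_unfinished_active i :
  active_at i -> #|unfinished (i + l.+1)| < #|unfinished i|.
Proof.
case/existsP => x /andP[xS /and3P[xv xi ix]]; apply: proper_card.
rewrite properE unfinishedS ?leq_addr //; apply/subsetPn; exists x.
  by rewrite inE xS xv.
rewrite inE xS xv -ltnNge /=.
by have /andP[/forall_inP/(_ _ xS)/andP[_ len] _] := tl; lia.
Qed.

(* The remaining fuel suffices for all intervals of the timeline that outlast
   the greedy interval in progress. *)
Lemma greedy_invariant i :
  #|unfinished (i + greedy_fuel i %% l.+1)| <= greedy_fuel i %/ l.+1.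
Proof.
elim: i => [|i IH] /=.
  rewrite modnMl mulnK //; have /andP[_ /forallP/(_ v)] := tl.
  apply: leq_trans; apply: subset_leq_card; apply/subsetP => x.
  by rewrite !inE => /andP[-> /andP[->]].
rewrite /greedy_act; have [d|d] /= := boolP (l.+1 %| _); last first.
  have [divE modE] := divmod_pred_ndvdn (ltn0Sn l) d.
  by rewrite subn1 divE addSnnS modE.
move/eqP: (d) IH => ->; rewrite addn0 => IH.
have [act_i|_] /= := boolP (active_at i); last first.
  rewrite subn0 (eqP d) addn0.
  exact: leq_trans (subset_leq_card (unfinishedS (leqnSn i))) IH.
have f0 : 0 < greedy_fuel i.
  have := leq_trans (active_at_unfinished act_i) IH.
  by case: (greedy_fuel i) => //; rewrite div0n.
have [divE modE] := divmod_pred_dvdn (ltn0Sn l) f0 d.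
rewrite f0 subn1 addSnnS modE -ltnS -divE.
exact: leq_trans (card_unfinished_active act_i) IH.
Qed.

Lemma greedy_covers (i : 'I_T) :
  active S v i -> greedy_act (greedy_fuel i) i.
Proof.
rewrite -[active S v i]/(active_at i) => act_i.
rewrite /greedy_act; have [d|] //= := boolP (l.+1 %| _).
rewrite act_i /= lt0n; apply/eqP => f0; have := greedy_invariant i.
by rewrite f0 mod0n div0n addn0 leqNgt active_at_unfinished.
Qed.

End Greedy.

Lemma schedule_of_timeline k l S : is_timeline k l S ->
  exists fuel act, schedule k l fuel act /\
    forall v (i : 'I_T), active S v i -> act v i.
Proof.
move=> tl; exists (greedy_fuel k l S).
exists (fun v i => greedy_act l S v (greedy_fuel k l S v i) i).
by split=> [v|v i]; [split=> //; apply: greedy_run | apply: greedy_covers].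
Qed.

Variable G : temporal_graph V T.

Definition neighbourhood (act : V -> nat -> bool) (i : 'I_T) : {set V} :=
  [set v | [exists u, act u i && (v \in closed_nbh (tnth G i) u)]].

Definition coverage (act : V -> nat -> bool) : nat :=
  \sum_(i < T) #|neighbourhood act i|.

Lemma card_dominated S :
  #|dominated G S| = \sum_(i < T) #|[set v | dominates G S v i]|.
Proof.
rewrite -sum1dep_card.
rewrite (eq_bigr (fun i : 'I_T => \sum_(v : V | dominates G S v i) 1)).
  rewrite pair_big_dep /= (reindex (fun p : V * 'I_T => (p.2, p.1))) //=.
  by exists (fun p => (p.2, p.1)) => -[].
by move=> i _; rewrite sum1dep_card.
Qed.

Lemma card_dominated_le S : #|dominated G S| <= #|V| * T.
Proof. by apply: leq_trans (max_card _) _; rewrite card_prod card_ord. Qed.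

Lemma timeline_partial_dominating_setP k l t :
  reflect (exists fuel act, schedule k l fuel act /\ t <= coverage act)
          (timeline_partial_dominating_set G k l t).
Proof.
apply: (iffP existsP) => [[S /andP[tl tS]]|[fuel [act [sch tc]]]].
  have [fuel [act [sch act_S]]] := schedule_of_timeline tl.
  exists fuel, act; split=> //; apply: leq_trans tS _.
  rewrite card_dominated; apply: leq_sum => i _; apply: subset_leq_card.
  apply/subsetP => v; rewrite !inE => /existsP[u /andP[/act_S au vu]].
  by apply/existsP; exists u; rewrite au.
have [S tl act_S] := timeline_of_schedule sch.
exists S; rewrite tl; apply: leq_trans tc _.
rewrite card_dominated; apply: leq_sum => i _; apply: subset_leq_card.
apply/subsetP => v; rewrite !inE => /existsP[u /andP[/act_S au vu]].
by apply/existsP; exists u; rewrite au.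
Qed.

Lemma timeline_partial_dominating_setW k k' l l' t : k <= k' -> l <= l' ->
  timeline_partial_dominating_set G k l t ->
  timeline_partial_dominating_set G k' l' t.
Proof.
move=> kk ll /existsP[S /andP[/andP[/forall_inP len /forallP num] tS]].
apply/existsP; exists S; rewrite tS andbT; apply/andP; split.
  by apply/forall_inP => x /len /andP[-> xl]; apply: leq_trans ll.
by apply/forallP => v; apply: leq_trans (num v) kk.
Qed.

Lemma coverage_saturated K : coverage (fun _ i => i < K) = #|V| * minn K T.
Proof.
rewrite -sum_ltn_ord big_distrr; apply: eq_bigr => i _ /=.
case: ltnP => iK; rewrite ?muln1 ?muln0.
  rewrite -cardsT; congr #|pred_of_set _|; apply/setP => v; rewrite !inE.
  by apply/existsP; exists v; rewrite iK inE eqxx.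
apply: eq_card0 => v; rewrite inE; apply/negbTE/existsPn => u.
by rewrite ltnNge iK.
Qed.

Lemma saturated_yes k l t : t <= #|V| * minn (k * l.+1) T ->
  timeline_partial_dominating_set G k l t.
Proof.
rewrite -coverage_saturated => tc; apply/timeline_partial_dominating_setP.
exists (fun _ i => k * l.+1 - i), (fun _ i => i < k * l.+1); split=> // v.
split=> [i iT|]; last by rewrite subn0.
split; first by rewrite subn_gt0.
  by rewrite -leqNgt -subn_eq0 => /eqP ->.
by case: ltnP; lia.
Qed.

Lemma oversized_no k l t :
  #|V| * T < t -> timeline_partial_dominating_set G k l t = false.
Proof.
move=> nTt; apply/negbTE/existsPn => S.
by rewrite negb_and -ltnNge (leq_ltn_trans (card_dominated_le S) nTt) orbT.
Qed.

End Schedules.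

(** * A loop language *)

(* In [Iter i x m e b] the body b is evaluated m times, with the number of
   completed rounds in i and the value of the previous round, initially that of
   e, in x. *)
Inductive expr :=
| Lit of nat
| Var of nat
| Plus of expr & expr
| Minus of expr & expr
| Input of expr
| Entry of expr
| Iter of nat & nat & expr & expr & expr.

Inductive cmd :=
| Put of expr & expr
| For of nat & expr & cmd.

Definition loop_cost (rounds : nat) (body_cost : nat -> nat) : nat :=
  2 + \sum_(j < rounds) (6 + body_cost j).

Section Semantics.

Variable inp : seq nat.
Implicit Types (rho h : nat -> nat) (e : expr) (c : cmd).

Fixpoint eval rho h e : nat :=
  match e with
  | Lit a => a
  | Var x => rho x
  | Plus e1 e2 => eval rho h e1 + eval rho h e2
  | Minus e1 e2 => eval rho h e1 - eval rho h e2
  | Input e1 => nth 0 inp (eval rho h e1)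
  | Entry e1 => h (eval rho h e1)
  | Iter i x m e0 b =>
      iteri (eval rho h m) (fun j a => eval (upd (upd rho i j) x a) h b)
        (eval rho h e0)
  end.

Fixpoint sem rho c h : nat -> nat :=
  match c with
  | Put a e => upd h (eval rho h a) (eval rho h e)
  | For i m c1 => iteri (eval rho h m) (fun j => sem (upd rho i j) c1) h
  end.

Fixpoint eval_cost rho h e : nat :=
  match e with
  | Lit _ => 1
  | Var _ => 2
  | Plus e1 e2 | Minus e1 e2 => eval_cost rho h e1 + eval_cost rho h e2 + 1
  | Input e1 => eval_cost rho h e1 + 1
  | Entry e1 => eval_cost rho h e1 + 4
  | Iter i x m e0 b =>
      let a j := iteri j (fun j a => eval (upd (upd rho i j) x a) h b)
        (eval rho h e0) in
      eval_cost rho h e0 + eval_cost rho h m +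
      loop_cost (eval rho h m)
        (fun j => eval_cost (upd (upd rho i j) x (a j)) h b + 2)
  end.

Fixpoint sem_cost rho c h : nat :=
  match c with
  | Put a e => eval_cost rho h a + eval_cost rho h e + 4
  | For i m c1 =>
      eval_cost rho h m +
      loop_cost (eval rho h m) (fun j =>
        sem_cost (upd rho i j) c1 (iteri j (fun j => sem (upd rho i j) c1) h))
  end.

Fixpoint rounds_le (M : nat) rho h e : Prop :=
  match e with
  | Lit _ | Var _ => True
  | Plus e1 e2 | Minus e1 e2 => rounds_le M rho h e1 /\ rounds_le M rho h e2
  | Input e1 | Entry e1 => rounds_le M rho h e1
  | Iter i x m e0 b =>
      [/\ rounds_le M rho h m, rounds_le M rho h e0, eval rho h m <= M &
          forall j a, j < eval rho h m ->
            rounds_le M (upd (upd rho i j) x a) h b]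
  end.

Fixpoint sem_rounds_le (M : nat) rho c : Prop :=
  match c with
  | Put a e => forall h, rounds_le M rho h a /\ rounds_le M rho h e
  | For i m c1 =>
      forall h, [/\ rounds_le M rho h m, eval rho h m <= M &
        forall j, j < eval rho h m -> sem_rounds_le M (upd rho i j) c1]
  end.

Fixpoint weight e : nat :=
  match e with
  | Lit _ => 1
  | Var _ => 2
  | Plus e1 e2 | Minus e1 e2 => weight e1 + weight e2 + 1
  | Input e1 => weight e1 + 1
  | Entry e1 => weight e1 + 4
  | Iter _ _ m e0 b => weight e0 + weight m + (weight b + 2 + 8)
  end.

Fixpoint cmd_weight c : nat :=
  match c with
  | Put a e => weight a + weight e + 4
  | For _ m c1 => weight m + (cmd_weight c1 + 8)
  end.

(* Taking the weight both as the factor and as the exponent makes these bounds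
   additive. *)
Definition poly_bound (w M : nat) : nat := w * M.+1 ^ w.

Lemma leq_poly_bound_const (x M : nat) : x <= poly_bound x M.
Proof. by rewrite leq_pmulr // expn_gt0. Qed.

Lemma leq_poly_bound_add (x1 x2 w1 w2 M : nat) :
  x1 <= poly_bound w1 M -> x2 <= poly_bound w2 M ->
  x1 + x2 <= poly_bound (w1 + w2) M.
Proof.
move=> le1 le2; apply: leq_trans (leq_add le1 le2) _.
rewrite /poly_bound mulnDl.
by rewrite leq_add ?leq_mul2l ?leq_pexp2l ?leq_addl ?leq_addr ?orbT.
Qed.

Lemma leq_poly_bound_loop (rounds w M : nat) (body_cost : nat -> nat) :
  rounds <= M -> (forall j, j < rounds -> body_cost j <= poly_bound w M) ->
  loop_cost rounds body_cost <= poly_bound (w + 8) M.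
Proof.
move=> mM body_le.
have round_le j : j < rounds -> 6 + body_cost j <= poly_bound (6 + w) M.
  by move=> /body_le; apply: leq_poly_bound_add; apply: leq_poly_bound_const.
apply: leq_trans (_ : 2 + M * poly_bound (6 + w) M <= _).
  rewrite leq_add2l.
  apply: leq_trans (_ : \sum_(j < rounds) poly_bound (6 + w) M <= _).
    by apply: leq_sum => j _; apply: round_le.
  by rewrite sum_nat_const card_ord leq_mul2r mM orbT.
have p0 : 0 < M.+1 ^ (6 + w) by rewrite expn_gt0.
by rewrite /poly_bound (_ : w + 8 = (6 + w).+2) ?expnS; nia.
Qed.

Lemma eval_cost_le M rho h e :
  rounds_le M rho h e -> eval_cost rho h e <= poly_bound (weight e) M.
Proof.
have const x := leq_poly_bound_const x M; have add := leq_poly_bound_add.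
elim: e rho => [a|x|e1 IH1 e2 IH2|e1 IH1 e2 IH2|e1 IH1|e1 IH1
  |i x m IHm e0 IH0 b IHb] rho /=.
- by move=> _; apply: const.
- by move=> _; apply: const.
- by case=> /IH1 le1 /IH2 le2; apply: (add) (const 1); apply: add.
- by case=> /IH1 le1 /IH2 le2; apply: (add) (const 1); apply: add.
- by move=> /IH1 le1; apply: add (const 1).
- by move=> /IH1 le1; apply: add (const 4).
case=> /IHm lem /IH0 le0 mM body_le; apply: (add); first exact: add.
apply: leq_poly_bound_loop => // j jm.
exact: add (IHb _ (body_le _ _ jm)) (const 2).
Qed.

Lemma sem_cost_le M rho c h :
  sem_rounds_le M rho c -> sem_cost rho c h <= poly_bound (cmd_weight c) M.
Proof.
elim: c rho h => [a e|i m c IH] rho h /= /(_ h).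
  case=> /eval_cost_le le_a /eval_cost_le le_e.
  apply: leq_poly_bound_add (leq_poly_bound_const 4 M).
  exact: leq_poly_bound_add.
case=> /eval_cost_le le_m mM body_le; apply: leq_poly_bound_add => //.
by apply: leq_poly_bound_loop => // j jm; apply: IH; apply: body_le.
Qed.

End Semantics.

(** * Compilation *)

(* Table entries live in the odd registers; variables and intermediate results
   share a stack of even registers. *)
Definition entry (a : nat) : nat := (2 * a).+1.
Definition slot (d : nat) : nat := 2 * d.

Definition copy (d d' : nat) : program :=
  [:: Const (slot d) 0; Add (slot d) (slot d) (slot d')].

Definition to_entry (d : nat) : program :=
  [:: Add (slot d) (slot d) (slot d); Const (slot d.+1) 1;
      Add (slot d) (slot d) (slot d.+1)].

(* Slot d holds the number of remaining rounds and slot d + 1 the number of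
   completed ones. *)
Definition loop (d pc : nat) (body : program) : program :=
  [:: Const (slot d.+1) 0; Jumpz (slot d) (pc + size body + 7)] ++ body ++
  [:: Const (slot d.+2) 1; Defs.Sub (slot d) (slot d) (slot d.+2);
      Add (slot d.+1) (slot d.+1) (slot d.+2);
      Const (slot d.+2) 0; Jumpz (slot d.+2) pc.+1].

(* The code is placed at address pc, finds variable x in slot [pos x], uses the
   slots from d on, and leaves the value in slot d. *)
Fixpoint compile_expr (e : expr) (pos : nat -> nat) (d pc : nat) : program :=
  match e with
  | Lit a => [:: Const (slot d) a]
  | Var x => copy d (pos x)
  | Plus e1 e2 =>
      let code1 := compile_expr e1 pos d pc in
      code1 ++ compile_expr e2 pos d.+1 (pc + size code1) ++
      [:: Add (slot d) (slot d) (slot d.+1)]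
  | Minus e1 e2 =>
      let code1 := compile_expr e1 pos d pc in
      code1 ++ compile_expr e2 pos d.+1 (pc + size code1) ++
      [:: Defs.Sub (slot d) (slot d) (slot d.+1)]
  | Input e1 => compile_expr e1 pos d pc ++ [:: Read (slot d) (slot d)]
  | Entry e1 =>
      compile_expr e1 pos d pc ++ to_entry d ++ [:: Fetch (slot d) (slot d)]
  | Iter i x m e0 b =>
      let code0 := compile_expr e0 pos d pc in
      let code1 := compile_expr m pos d.+1 (pc + size code0) in
      let pc' := pc + size code0 + size code1 in
      code0 ++ code1 ++
      loop d.+1 pc'
        (compile_expr b (upd (upd pos i d.+2) x d) d.+3 pc'.+2 ++
         copy d d.+3)
  end.

Fixpoint compile_cmd (c : cmd) (pos : nat -> nat) (d pc : nat) : program :=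
  match c with
  | Put a e =>
      let code1 := compile_expr a pos d pc ++ to_entry d in
      code1 ++ compile_expr e pos d.+1 (pc + size code1) ++
      [:: Store (slot d) (slot d.+1)]
  | For i m c1 =>
      let code1 := compile_expr m pos d pc in
      code1 ++
      loop d (pc + size code1)
        (compile_cmd c1 (upd pos i d.+1) d.+2 (pc + size code1).+2)
  end.

(* No variable is in scope at the start: all of them are mapped to slot 0, which
   is never written. *)
Definition compile (c : cmd) (e : expr) : program :=
  let code1 := compile_cmd c (fun=> 0) 1 0 in
  let code2 := compile_expr e (fun=> 0) 1 (size code1) in
  code1 ++ code2 ++
  [:: Jumpz (slot 1) (size code1 + size code2 + 2); Accept; Reject].

Section Execution.

Variables (inp : seq nat) (P : program).
Implicit Types (R : memory) (pc d s : nat) (code : program).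

Definition steps s pc R pc' R' : Prop :=
  forall fuel, exec P inp (s + fuel) pc R = exec P inp fuel pc' R'.

Lemma steps_trans pc2 R2 s1 s2 pc1 pc3 R1 R3 :
  steps s1 pc1 R1 pc2 R2 -> steps s2 pc2 R2 pc3 R3 ->
  steps (s1 + s2) pc1 R1 pc3 R3.
Proof. by move=> st1 st2 fuel; rewrite -addnA st1. Qed.

Fixpoint code_at pc code : Prop :=
  if code is i :: code' then onth P pc = Some i /\ code_at pc.+1 code'
  else True.

Lemma code_at_cat pc code1 code2 :
  code_at pc (code1 ++ code2) <->
  code_at pc code1 /\ code_at (pc + size code1) code2.
Proof.
elim: code1 pc => [|i code1 IH] pc /=; first by rewrite addn0; split=> // -[].
by rewrite IH addSnnS; split=> [[? []]|[[]]].
Qed.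

Arguments code_at : simpl never.

Definition straight (i : instr) : bool :=
  match i with Jumpz _ _ | Accept | Reject => false | _ => true end.

Definition run1 R (i : instr) : memory :=
  match i with
  | Const x c => upd R x c
  | Add x y z => upd R x (R y + R z)
  | Defs.Sub x y z => upd R x (R y - R z)
  | Fetch x y => upd R x (R (R y))
  | Store x y => upd R (R x) (R y)
  | Read x y => upd R x (nth 0 inp (R y))
  | _ => R
  end.

Definition run code R : memory := foldl run1 R code.

Lemma steps_straight pc R code :
  code_at pc code -> all straight code ->
  steps (size code) pc R (pc + size code) (run code R).
Proof.
elim: code pc R => [|i code IH] pc R /=; first by rewrite addn0.
move=> [Pi at_code] /andP[si sc] fuel; have := IH _ (run1 R i) at_code sc fuel.
by rewrite addSnnS => <-; case: i Pi si => //= [a b|a b c|a b c|a b|a b|a b] ->.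
Qed.

Lemma steps_jumpz pc R x p :
  onth P pc = Some (Jumpz x p) ->
  steps 1 pc R (if R x == 0 then p else pc.+1) R.
Proof. by move=> Pi fuel /=; rewrite Pi. Qed.

Definition frame d R R' : Prop :=
  forall a, (forall j, d <= j -> a <> slot j) -> R' a = R a.

Lemma frame_trans d R1 R2 R3 :
  frame d R1 R2 -> frame d R2 R3 -> frame d R1 R3.
Proof. by move=> fr12 fr23 a a_out; rewrite fr23 // fr12. Qed.

Lemma frameW d d' R R' : d <= d' -> frame d' R R' -> frame d R R'.
Proof. by move=> dd' h a ha; apply: h => j /(leq_trans dd')/ha. Qed.

Lemma frame_upd d j a R : d <= j -> frame d R (upd R (slot j) a).
Proof. by move=> dj b hb; rewrite /upd; case: eqP => // /hb; case. Qed.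

Lemma frame_slot d j R R' : frame d R R' -> j < d -> R' (slot j) = R (slot j).
Proof. by move=> h jd; apply: h => i; rewrite /slot; lia. Qed.

Lemma frame_entry d a R R' : frame d R R' -> R' (entry a) = R (entry a).
Proof. by apply=> j _; rewrite /slot /entry; lia. Qed.

Lemma upd_eq R x a : upd R x a x = a.
Proof. by rewrite /upd eqxx. Qed.

Lemma upd_neq R x y a : y != x -> upd R x a y = R y.
Proof. by rewrite /upd => /negbTE ->. Qed.

Lemma upd_slot R i j a :
  upd R (slot i) a (slot j) = if j == i then a else R (slot j).
Proof. by rewrite /upd /slot eqn_mul2l. Qed.

Lemma run_copy d d' R : d != d' ->
  run (copy d d') R (slot d) = R (slot d') /\ frame d R (run (copy d d') R).
Proof.
move=> dd'; rewrite /= !upd_slot eqxx eq_sym (negbTE dd'); split=> //.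
by apply: frame_trans; apply: frame_upd.
Qed.

Lemma run_to_entry d R :
  run (to_entry d) R (slot d) = entry (R (slot d)) /\
  frame d R (run (to_entry d) R).
Proof.
split; last first.
  by rewrite /=; do 3 (apply: frame_trans; last by apply: frame_upd; lia).
rewrite /= !upd_slot !eqxx !ifF /entry ?mul2n ?addnn ?addn1 //; lia.
Qed.

Section Loop.

Variables (d pc m : nat) (body : program) (w : nat -> nat).
Variable Inv : nat -> memory -> Prop.
Hypothesis at_loop : code_at pc (loop d pc body).
Hypothesis Inv_frame : forall j R R', frame d R R' -> Inv j R -> Inv j R'.
Hypothesis Inv_body : forall j R, j < m -> Inv j R -> R (slot d.+1) = j ->
  exists R', [/\ Inv j.+1 R', R' (slot d) = R (slot d), R' (slot d.+1) = j &
    steps (w j) pc.+2 R (pc.+2 + size body) R'].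

Lemma steps_round j R :
  j < m -> Inv j R -> R (slot d.+1) = j -> R (slot d) = m - j ->
  exists R', [/\ Inv j.+1 R', R' (slot d.+1) = j.+1, R' (slot d) = m - j.+1 &
    steps (6 + w j) pc.+1 R pc.+1 R'].
Proof.
move=> jm IR Rj Rmj.
have [_ [at_test /code_at_cat[_ at_back]]] := at_loop.
have [R1 [IR1 R1mj R1j st]] := Inv_body jm IR Rj.
pose back := [:: Const (slot d.+2) 1; Defs.Sub (slot d) (slot d) (slot d.+2);
      Add (slot d.+1) (slot d.+1) (slot d.+2); Const (slot d.+2) 0].
have [at_straight [at_jump _]] := (code_at_cat _ back _).1 at_back.
have fr : frame d R1 (run back R1).
  by rewrite /=; do 4 (apply: frame_trans; last by apply: frame_upd; lia).
exists (run back R1); split.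
- exact: Inv_frame fr IR1.
- by rewrite /= !upd_slot !eqxx !ifF ?R1j ?addn1 //; lia.
- by rewrite /= !upd_slot !eqxx !ifF ?R1mj ?Rmj //; lia.
have -> : 6 + w j = 1 + (w j + (size back + 1)) by rewrite /=; lia.
have := steps_jumpz R at_test; rewrite Rmj ifF; last by lia.
move=> /steps_trans; apply; apply: steps_trans st _.
apply: steps_trans (steps_straight R1 at_straight isT) _.
have jump0 : run back R1 (slot d.+2) = 0 by rewrite /= upd_eq.
by have := steps_jumpz (run back R1) at_jump; rewrite jump0.
Qed.

Lemma steps_loop R :
  Inv 0 R -> R (slot d) = m ->
  exists R', Inv m R' /\
    steps (loop_cost m w) pc R (pc + size (loop d pc body)) R'.
Proof.
move=> I0 Rm; have [at_start [at_test _]] := at_loop.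
have fr : frame d R (upd R (slot d.+1) 0) by apply: frame_upd.
have rounds : forall j, j <= m -> exists R', [/\ Inv j R', R' (slot d.+1) = j,
    R' (slot d) = m - j &
    steps (1 + \sum_(i < j) (6 + w i)) pc R pc.+1 R'].
  elim=> [_|j IH jm].
    exists (upd R (slot d.+1) 0); rewrite big_ord0 subn0 !upd_slot eqxx.
    rewrite ltn_eqF //; split=> //; first exact: Inv_frame fr I0.
    by move=> fuel /=; rewrite at_start.
  have [R1 [IR1 R1j R1mj st1]] := IH (ltnW jm).
  have [R2 [IR2 R2j R2mj st2]] := steps_round jm IR1 R1j R1mj.
  exists R2; split=> //; rewrite big_ord_recr addnA.
  exact: steps_trans st1 st2.
have [R1 [IR1 _ R1m st1]] := rounds m (leqnn m).
exists R1; split=> //; rewrite /loop_cost -[2]/(1 + 1) addnAC.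
apply: steps_trans st1 _; have := steps_jumpz R1 at_test.
rewrite R1m subnn eqxx; congr (steps 1 pc.+1 R1 _ R1).
by rewrite /loop !size_cat /=; lia.
Qed.

End Loop.
Definition represents (pos : nat -> nat) d (rho h : nat -> nat) R : Prop :=
  (forall x, pos x < d /\ R (slot (pos x)) = rho x) /\
  (forall a, R (entry a) = h a).

Lemma represents_frame pos d d' rho h R R' :
  represents pos d rho h R -> frame d R R' -> d <= d' ->
  represents pos d' rho h R'.
Proof.
move=> [vars entries] fr dd'; split=> [x|a]; last by rewrite (frame_entry _ fr).
have [xd xR] := vars x; split; first exact: leq_trans dd'.
by rewrite (frame_slot fr).
Qed.

Lemma represents_bind pos d rho h R x j :
  represents pos d rho h R -> j < d ->
  represents (upd pos x j) d (upd rho x (R (slot j))) h R.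
Proof.
by move=> [vars entries] jd; split=> // y; rewrite /upd; case: eqP.
Qed.

Definition computes d v s pc pc' R : Prop :=
  exists R', [/\ frame d R R', R' (slot d) = v & steps s pc R pc' R'].

Definition expr_correct (e : expr) : Prop :=
  forall pos d pc rho h R,
    code_at pc (compile_expr e pos d pc) -> represents pos d rho h R ->
    computes d (eval inp rho h e) (eval_cost inp rho h e) pc
      (pc + size (compile_expr e pos d pc)) R.

Lemma computes_cat d v v' s pc code code' R :
  code_at pc (code ++ code') -> all straight code' ->
  (code_at pc code -> computes d v s pc (pc + size code) R) ->
  (forall R', frame d R R' -> R' (slot d) = v ->
     run code' R' (slot d) = v' /\ frame d R' (run code' R')) ->
  computes d v' (s + size code') pc (pc + size (code ++ code')) R.
Proof.
case/code_at_cat=> at_code at_code' str /(_ at_code)[R1 [fr1 v1 st1]].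
case/(_ _ fr1 v1)=> v2 fr2.
exists (run code' R1); split=> //; first exact: frame_trans fr2.
rewrite size_cat addnA; apply: steps_trans st1 _.
exact: steps_straight.
Qed.

Lemma computes_binary (op : nat -> nat -> nat) (i : instr) d v1 v2 s1 s2 pc
    code1 code2 R :
  straight i -> (forall R', run1 R' i =
    upd R' (slot d) (op (R' (slot d)) (R' (slot d.+1)))) ->
  code_at pc (code1 ++ code2 ++ [:: i]) ->
  (code_at pc code1 -> computes d v1 s1 pc (pc + size code1) R) ->
  (forall R', frame d R R' -> code_at (pc + size code1) code2 ->
     computes d.+1 v2 s2 (pc + size code1) (pc + size code1 + size code2) R') ->
  computes d (op v1 v2) (s1 + s2 + 1) pc
    (pc + size (code1 ++ code2 ++ [:: i])) R.
Proof.
move=> str runi /code_at_cat[at1 /code_at_cat[at2 at_i]].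
move=> /(_ at1)[R1 [fr1 e1 st1]] /(_ _ fr1 at2)[R2 [fr2 e2 st2]].
exists (run1 R2 i); split.
- rewrite runi; apply: frame_trans fr1 _.
  by apply: frame_trans (frameW (leqnSn d) fr2) _; apply: frame_upd.
- by rewrite runi upd_eq e2 (frame_slot fr2) ?e1.
rewrite !size_cat !addnA; apply: steps_trans (steps_trans st1 st2) _.
by apply: (steps_straight R2 at_i); rewrite /= str.
Qed.

Lemma iter_correct i x m e b :
  expr_correct m -> expr_correct e -> expr_correct b ->
  expr_correct (Iter i x m e b).
Proof.
move=> IHm IHe IHb pos d pc rho h R /=.
set code0 := compile_expr e pos d pc.
set code1 := compile_expr m pos d.+1 _; set pc' := _ + size code1.
set code2 := compile_expr b _ _ _.
case/code_at_cat=> at0 /code_at_cat[at1 at_loop] repr.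
have [R0 [fr0 v0 st0]] := IHe _ _ _ _ _ _ at0 repr.
have repr0 := represents_frame repr fr0 (leqnSn d).
have [R1 [fr1 v1 st1]] := IHm _ _ _ _ _ _ at1 repr0.
pose f j a := eval inp (upd (upd rho i j) x a) h b.
pose a0 := eval inp rho h e.
pose Inv j R' := frame d R R' /\ R' (slot d) = iteri j f a0.
have Inv_frame j R2 R3 : frame d.+1 R2 R3 -> Inv j R2 -> Inv j R3.
  move=> fr [fr2 v2]; split; last by rewrite (frame_slot fr).
  exact: frame_trans fr2 (frameW (leqnSn d) fr).
have Inv1 : Inv 0 R1.
  split; last by rewrite (frame_slot fr1) ?v0.
  exact: frame_trans fr0 (frameW (leqnSn d) fr1).
have [|R2 [[fr2 v2] st2]] := steps_loop (w := fun j =>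
    eval_cost inp (upd (upd rho i j) x (iteri j f a0)) h b + 2)
    at_loop Inv_frame _ Inv1 v1; last first.
  exists R2; split=> //; rewrite 2!size_cat 2!addnA.
  exact: steps_trans (steps_trans st0 st1) st2.
move=> j R2 _ [fr2 v2] v2j; have [_ [_]] := at_loop; rewrite -/code2.
case/code_at_cat=> /code_at_cat[at_body at_copy] _.
have := represents_frame repr fr2 (leq_addr 3 d); rewrite addn3 => repr2.
have d_lt : d < d.+3 by lia.
have := represents_bind x (represents_bind i repr2 (ltnSn _)) d_lt.
rewrite v2 v2j => repr3.
have [R3 [fr3 v3 st3]] := IHb _ _ _ _ _ _ at_body repr3.
have [v4 fr4] := run_copy R3 (negbT (ltn_eqF d_lt)).
exists (run (copy d d.+3) R3); split.
- split; last by rewrite v4 v3.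
  by apply: frame_trans fr2 _; apply: frame_trans fr4; apply: frameW fr3; lia.
- by rewrite /= !upd_slot !ifF ?(frame_slot fr3) //; lia.
- by rewrite /= !upd_slot !ifF ?(frame_slot fr3) //; lia.
rewrite size_cat addnA; apply: steps_trans st3 _.
exact: (steps_straight R3 at_copy).
Qed.

Lemma compile_expr_correct e : expr_correct e.
Proof.
elim: e => [a|x|e1 IH1 e2 IH2|e1 IH1 e2 IH2|e1 IH1|e1 IH1|i x m IHm e IHe b IHb]
  pos d pc rho h R /=.
- move=> at_code _; exists (upd R (slot d) a); rewrite upd_eq; split=> //.
    exact: frame_upd.
  exact: (steps_straight R at_code).
- move=> at_code [vars _]; have [xd xR] := vars x.
  have [v fr] := run_copy R (negbT (gtn_eqF xd)).
  exists (run (copy d (pos x)) R); rewrite v; split=> //.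
  exact: (steps_straight R at_code).
- move=> at_code repr.
  apply: (computes_binary (op := addn) _ _ at_code) => // [at1|R' fr at2].
    exact: IH1.
  by apply: IH2 at2 (represents_frame repr fr _).
- move=> at_code repr.
  apply: (computes_binary (op := subn) _ _ at_code) => // [at1|R' fr at2].
    exact: IH1.
  by apply: IH2 at2 (represents_frame repr fr _).
- move=> at_code repr.
  apply: (computes_cat (v := eval inp rho h e1) at_code) => // [at1|].
    exact: IH1.
  by move=> R' _ v; rewrite /= upd_eq v; split=> //; apply: frame_upd.
- move=> at_code repr.
  apply: (computes_cat (v := eval inp rho h e1) at_code) => // [at1|].
    exact: IH1.
  move=> R' fr v; have [v' fr'] := run_to_entry d R'.
  rewrite -[run _ R']/(run1 (run (to_entry d) R') (Fetch (slot d) (slot d))).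
  set R2 := run _ R' in v' fr' *; rewrite /= upd_eq v' v.
  have [_ entries] := represents_frame repr (frame_trans fr fr') (leqnn d).
  by rewrite entries; split=> //; apply: frame_trans fr' _; apply: frame_upd.
- exact: iter_correct.
Qed.

Definition cmd_correct (c : cmd) : Prop :=
  forall pos d pc rho h R,
    code_at pc (compile_cmd c pos d pc) -> represents pos d rho h R ->
    exists2 R', represents pos d rho (sem inp rho c h) R' &
      (forall j, j < d -> R' (slot j) = R (slot j)) /\
      steps (sem_cost inp rho c h) pc R (pc + size (compile_cmd c pos d pc)) R'.

Lemma put_correct a e : cmd_correct (Put a e).
Proof.
move=> pos d pc rho h R; rewrite /compile_cmd.
set code1 := _ ++ to_entry d; set code2 := compile_expr e _ _ _.
case/code_at_cat=> at1 /code_at_cat[at2 at_store] repr.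
have [R1 [fr1 v1 st1]] :
  computes d (entry (eval inp rho h a)) (eval_cost inp rho h a + 3) pc
    (pc + size code1) R.
  apply: (computes_cat (v := eval inp rho h a) at1) => // [at_a|].
    exact: compile_expr_correct.
  by move=> R' _ <-; apply: run_to_entry.
have repr1 := represents_frame repr fr1 (leqnSn d).
have [R2 [fr2 v2 st2]] := compile_expr_correct at2 repr1.
have fr := frame_trans fr1 (frameW (leqnSn d) fr2).
have [vars entries] := represents_frame repr fr (leqnn d).
have addrE : R2 (slot d) = entry (eval inp rho h a) by rewrite (frame_slot fr2).
have slot_entry j x : (slot j == entry x) = false by rewrite /slot /entry; lia.
exists (run1 R2 (Store (slot d) (slot d.+1))); rewrite /= addrE v2.
  split=> [x|b]; first by have [] := vars x; rewrite upd_neq ?slot_entry.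
  by rewrite /upd -entries /entry eqSS eqn_mul2l.
split=> [j jd|]; first by rewrite upd_neq ?slot_entry // (frame_slot fr).
rewrite 2!size_cat !addnA -[4]/(3 + 1) addnA [_ + _ + 3]addnAC.
apply: steps_trans (steps_trans st1 st2) _; rewrite -addrE -v2.
exact: (steps_straight R2 at_store).
Qed.

Lemma compile_cmd_correct c : cmd_correct c.
Proof.
elim: c => [a e|i m c IH]; first exact: put_correct.
move=> pos d pc rho h R; rewrite /compile_cmd -/compile_cmd.
set code1 := compile_expr m pos d pc; set code2 := compile_cmd c _ _ _.
case/code_at_cat=> at1 at_loop repr.
have [R1 [fr1 v1 st1]] := compile_expr_correct at1 repr.
pose f j := sem inp (upd rho i j) c.
pose Inv j R' := represents pos d rho (iteri j f h) R' /\
  forall j', j' < d -> R' (slot j') = R (slot j').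
have Inv_frame j R2 R3 : frame d R2 R3 -> Inv j R2 -> Inv j R3.
  move=> fr [repr2 slots2]; split; first exact: represents_frame repr2 fr _.
  by move=> j' jd; rewrite (frame_slot fr) ?slots2.
have Inv1 : Inv 0 R1.
  split; first exact: represents_frame repr fr1 _.
  by move=> j' jd; rewrite (frame_slot fr1).
have [|R2 [[repr2 slots2] st2]] := steps_loop (w := fun j =>
    sem_cost inp (upd rho i j) c (iteri j f h)) at_loop Inv_frame _ Inv1 v1;
  last first.
  exists R2 => //; split=> //; rewrite size_cat addnA.
  exact: steps_trans st1 st2.
move=> j R2 _ [repr2 slots2] v2j; have [_ [_]] := at_loop.
case/code_at_cat=> at_body _.
have := represents_frame repr2 (fun _ _ => erefl) (leq_addr 2 d).
rewrite addn2 => /(represents_bind i)/(_ (ltnSn d.+1)); rewrite v2j => repr3.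
have [R3 [vars3 entries3] [slots3 st3]] := IH _ _ _ _ _ _ at_body repr3.
exists R3; rewrite !slots3 ?v2j //; split=> //.
split; last by move=> j' jd; rewrite slots3 ?slots2 // !leqW.
split=> // x; have [xd _] := repr2.1 x; split=> //.
by rewrite slots3 ?(repr2.1 x).2 // !leqW.
Qed.

End Execution.

Lemma exec_compile (inp : seq nat) (c : cmd) (e : expr) (fuel : nat)
    (h := sem inp (fun=> 0) c (fun=> 0)) :
  sem_cost inp (fun=> 0) c (fun=> 0) + eval_cost inp (fun=> 0) h e + 2
    <= fuel ->
  answers_within (compile c e) inp fuel (eval inp (fun=> 0) h e != 0).
Proof.
move=> le_fuel; set P := compile c e.
have at_P : code_at P 0 P.
  have at_cat code1 code2 : code_at (code1 ++ code2) (size code1) code2.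
    elim: code2 code1 => // i code2 IH code1; split.
      by elim: code1 {IH} => //=.
    by rewrite -cat_rcons -(size_rcons code1 i); apply: IH.
  exact: (at_cat [::]).
have := at_P; rewrite {2}/P /compile.
set code1 := compile_cmd _ _ _ _; set code2 := compile_expr _ _ _ _.
case/code_at_cat=> at1 /code_at_cat[at2]; rewrite add0n in at2 *.
case=> at_jump [at_accept [at_reject _]].
have repr0 : represents (fun=> 0) 1 (fun=> 0) (fun=> 0) (fun=> 0) by [].
have [R1 repr1 [_ st1]] := compile_cmd_correct inp at1 repr0.
have [R2 [_ v2 st2]] := compile_expr_correct inp at2 repr1.
have st := steps_trans (steps_trans st1 st2) (steps_jumpz inp R2 at_jump).
rewrite v2 in st; rewrite /answers_within -(subnKC le_fuel).
have -> a b : a + b + 2 + (fuel - (a + b + 2)) =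
  a + b + 1 + (fuel - (a + b + 2)).+1 by lia.
have halt k pc b : onth P pc = Some (if b then Accept else Reject) ->
  exec P inp k.+1 pc R2 = Some b by move=> /= ->; case: b.
by rewrite st -/h; case: (_ == 0); apply: halt; rewrite ?addn2.
Qed.

(** * Derived expressions *)

(* Derived expressions bind variables above the bounds of their arguments, so
   that these are not captured. *)
Fixpoint bound (e : expr) : nat :=
  match e with
  | Lit _ => 0
  | Var x => x.+1
  | Plus e1 e2 | Minus e1 e2 => maxn (bound e1) (bound e2)
  | Input e1 | Entry e1 => bound e1
  | Iter _ _ m e0 b => maxn (bound m) (maxn (bound e0) (bound b))
  end.

Definition Min (e1 e2 : expr) : expr := Minus e1 (Minus e1 e2).
Definition Max (e1 e2 : expr) : expr := Plus e1 (Minus e2 e1).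

Definition Eqz (e : expr) : expr := Minus (Lit 1) e.
Definition Nz (e : expr) : expr := Eqz (Eqz e).
Definition Leq (e1 e2 : expr) : expr := Eqz (Minus e1 e2).
Definition Eq (e1 e2 : expr) : expr := Eqz (Plus (Minus e1 e2) (Minus e2 e1)).
Definition And (e1 e2 : expr) : expr := Eqz (Plus (Eqz e1) (Eqz e2)).
Definition Or (e1 e2 : expr) : expr := Nz (Plus e1 e2).

Definition Fold (f : expr -> expr -> expr) (i : nat) (m b : expr) : expr :=
  let x := maxn i.+1 (bound b) in Iter i x m (Lit 0) (f (Var x) b).

Definition Sum : nat -> expr -> expr -> expr := Fold Plus.
Definition BigMax : nat -> expr -> expr -> expr := Fold Max.

Definition All (i : nat) (m b : expr) : expr := Eqz (Sum i m (Eqz b)).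
Definition Any (i : nat) (m b : expr) : expr := Nz (Sum i m b).

Definition Times (e1 e2 : expr) : expr := Sum (bound e2) e1 e2.

Definition Pow (e m : expr) : expr :=
  let x := (bound e).+1 in Iter (bound e) x m (Lit 1) (Times e (Var x)).

Definition Div (e1 e2 : expr) : expr :=
  let i := maxn (bound e1) (bound e2) in
  Sum i e1 (Leq (Times (Plus (Var i) (Lit 1)) e2) e1).

Definition Mod (e1 e2 : expr) : expr := Minus e1 (Times (Div e1 e2) e2).

Definition Digit (b e u : expr) : expr := Mod (Div e (Pow b u)) b.

Lemma divn_sum (x y : nat) : 0 < y -> x %/ y = \sum_(i < x) (i.+1 * y <= x).
Proof.
move=> y0; under eq_bigr => i _ do rewrite -leq_divRL //.
by rewrite sum_ltn_ord (minn_idPl (leq_div _ _)).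
Qed.

Section Evaluation.

Variable inp : seq nat.
Implicit Types (rho h : nat -> nat) (e b m : expr).

Lemma eval_ext e rho rho' h :
  (forall x, x < bound e -> rho x = rho' x) ->
  eval inp rho h e = eval inp rho' h e.
Proof.
elim: e rho rho'
  => [a|x|e1 IH1 e2 IH2|e1 IH1 e2 IH2|e1 IH1|e1 IH1|i x m IHm e IHe b IHb]
  rho rho' /= eqr.
- by [].
- exact: eqr.
- by congr (_ + _); [apply: IH1 | apply: IH2] => x xb; apply: eqr;
    rewrite leq_max xb ?orbT.
- by congr (_ - _); [apply: IH1 | apply: IH2] => x xb; apply: eqr;
    rewrite leq_max xb ?orbT.
- by congr nth; apply: IH1.
- by congr h; apply: IH1.
rewrite (IHm rho rho') ?(IHe rho rho') => [|y yb|y yb];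
  try by apply: eqr; rewrite !leq_max yb ?orbT.
apply: eq_iteri => j a; apply: IHb => y yb; rewrite /upd.
by rewrite eqr // !leq_max yb !orbT.
Qed.

Lemma eval_upd rho h e x a :
  bound e <= x -> eval inp (upd rho x a) h e = eval inp rho h e.
Proof.
by move=> ex; apply: eval_ext => y ye; rewrite upd_neq // ltn_eqF //; lia.
Qed.

Lemma eval_min rho h e1 e2 :
  eval inp rho h (Min e1 e2) = minn (eval inp rho h e1) (eval inp rho h e2).
Proof. by rewrite /=; lia. Qed.

Lemma eval_eqz rho h e : eval inp rho h (Eqz e) = (eval inp rho h e == 0).
Proof. by rewrite /=; lia. Qed.

Lemma eval_nz rho h e : eval inp rho h (Nz e) = (eval inp rho h e != 0).
Proof. by rewrite !eval_eqz eqb0. Qed.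

Lemma eval_leq rho h e1 e2 :
  eval inp rho h (Leq e1 e2) = (eval inp rho h e1 <= eval inp rho h e2).
Proof. by rewrite eval_eqz. Qed.

Lemma eval_eq rho h e1 e2 :
  eval inp rho h (Eq e1 e2) = (eval inp rho h e1 == eval inp rho h e2).
Proof. by rewrite eval_eqz /=; lia. Qed.

Lemma eval_and rho h e1 e2 :
  eval inp rho h (And e1 e2) =
  (eval inp rho h e1 != 0) && (eval inp rho h e2 != 0).
Proof.
have eval_sub1 e : 1 - eval inp rho h e = (eval inp rho h e == 0) by lia.
by rewrite eval_eqz /= addn_eq0 !eval_sub1 !eqb0.
Qed.

Lemma eval_or rho h e1 e2 :
  eval inp rho h (Or e1 e2) =
  (eval inp rho h e1 != 0) || (eval inp rho h e2 != 0).
Proof. by rewrite eval_nz /= addn_eq0 negb_and. Qed.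

Lemma eval_sum rho h i m b :
  eval inp rho h (Sum i m b) =
  \sum_(j < eval inp rho h m) eval inp (upd rho i j) h b.
Proof.
rewrite /Sum /Fold /=; elim: (eval inp rho h m) => [|k IH].
  by rewrite big_ord0.
by rewrite big_ord_recr iteriS IH upd_eq eval_upd ?leq_maxr.
Qed.

Lemma eval_bigmax rho h i m b :
  eval inp rho h (BigMax i m b) =
  \max_(j < eval inp rho h m) eval inp (upd rho i j) h b.
Proof.
rewrite /BigMax /Fold /=; elim: (eval inp rho h m) => [|k IH].
  by rewrite big_ord0.
by rewrite big_ord_recr iteriS IH upd_eq eval_upd ?leq_maxr // -maxnE.
Qed.

Lemma eval_all rho h i m b :
  eval inp rho h (All i m b) =
  [forall j : 'I_(eval inp rho h m), eval inp (upd rho i j) h b != 0].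
Proof.
rewrite eval_eqz eval_sum sum_nat_eq0; congr nat_of_bool.
apply: eq_forallb => j.
by rewrite eval_eqz eqb0.
Qed.

Lemma eval_any rho h i m b :
  eval inp rho h (Any i m b) =
  [exists j : 'I_(eval inp rho h m), eval inp (upd rho i j) h b != 0].
Proof. by rewrite eval_nz eval_sum sum_nat_eq0 negb_forall. Qed.

Lemma eval_times rho h e1 e2 :
  eval inp rho h (Times e1 e2) = eval inp rho h e1 * eval inp rho h e2.
Proof.
rewrite eval_sum; under eq_bigr => j _ do rewrite eval_upd //.
by rewrite sum_nat_const card_ord.
Qed.

Lemma eval_pow rho h e m :
  eval inp rho h (Pow e m) = eval inp rho h e ^ eval inp rho h m.
Proof.
have stepE j a :
  eval inp (upd (upd rho (bound e) j) (bound e).+1 a) h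
    (Times e (Var (bound e).+1)) = eval inp rho h e * a.
  by rewrite eval_times /= upd_eq !eval_upd.
transitivity (iteri (eval inp rho h m) (fun=> muln (eval inp rho h e)) 1).
  exact: eq_iteri.
by elim: (eval inp rho h m) => //= k ->; rewrite expnS.
Qed.

Lemma eval_div rho h e1 e2 : 0 < eval inp rho h e2 ->
  eval inp rho h (Div e1 e2) = eval inp rho h e1 %/ eval inp rho h e2.
Proof.
move=> e20; rewrite eval_sum divn_sum //; apply: eq_bigr => j _.
by rewrite eval_leq eval_times /= upd_eq !eval_upd ?leq_maxl ?leq_maxr ?addn1.
Qed.

Lemma eval_mod rho h e1 e2 : 0 < eval inp rho h e2 ->
  eval inp rho h (Mod e1 e2) = eval inp rho h e1 %% eval inp rho h e2.
Proof.
move=> e20.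
rewrite -[LHS]/(eval inp rho h e1 - eval inp rho h (Times (Div e1 e2) e2)).
rewrite eval_times eval_div //.
by rewrite {1}(divn_eq (eval inp rho h e1) (eval inp rho h e2)) addKn.
Qed.

Lemma eval_digit rho h b e u : 0 < eval inp rho h b ->
  eval inp rho h (Digit b e u) =
  digit (eval inp rho h b) (eval inp rho h e) (eval inp rho h u).
Proof.
by move=> b0; rewrite /Digit eval_mod // eval_div eval_pow // expn_gt0 b0.
Qed.

Section Rounds.

Variable M : nat.

Local Notation rounds_le := (rounds_le inp M).

Lemma rounds_le_ext e rho rho' h :
  (forall x, x < bound e -> rho x = rho' x) ->
  rounds_le rho h e -> rounds_le rho' h e.
Proof.
elim: e rho rho'
  => [a|x|e1 IH1 e2 IH2|e1 IH1 e2 IH2|e1 IH1|e1 IH1|i x m IHm e IHe b IHb]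
  rho rho' //= eqr.
- by case=> r1 r2; split; [apply: IH1 r1 | apply: IH2 r2] => x xb; apply: eqr;
    rewrite leq_max xb ?orbT.
- by case=> r1 r2; split; [apply: IH1 r1 | apply: IH2 r2] => x xb; apply: eqr;
    rewrite leq_max xb ?orbT.
- exact: IH1.
- exact: IH1.
have eqm y : y < bound m -> rho y = rho' y.
  by move=> ym; apply: eqr; rewrite leq_max ym.
rewrite (eval_ext h eqm) => -[rm re mM rb]; split=> //.
- exact: IHm rm.
- by apply: IHe re => y ye; apply: eqr; rewrite !leq_max ye orbT.
move=> j a jm; apply: IHb (rb j a jm) => y yb; rewrite /upd.
by rewrite eqr // !leq_max yb !orbT.
Qed.

Lemma rounds_le_upd rho h e x a :
  bound e <= x -> rounds_le rho h e -> rounds_le (upd rho x a) h e.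
Proof.
move=> ex; apply: rounds_le_ext => y ye.
by rewrite upd_neq // ltn_eqF //; lia.
Qed.

Lemma rounds_le_fold f rho h i m b :
  (forall rho' x e, rounds_le rho' h e -> rounds_le rho' h (f (Var x) e)) ->
  rounds_le rho h m -> eval inp rho h m <= M ->
  (forall j, j < eval inp rho h m -> rounds_le (upd rho i j) h b) ->
  rounds_le rho h (Fold f i m b).
Proof.
move=> rf rm mM rb; split=> // j a /rb rbj.
by apply: rf; apply: rounds_le_upd; rewrite ?leq_maxr.
Qed.

Lemma rounds_le_sum rho h i m b :
  rounds_le rho h m -> eval inp rho h m <= M ->
  (forall j, j < eval inp rho h m -> rounds_le (upd rho i j) h b) ->
  rounds_le rho h (Sum i m b).
Proof. exact: rounds_le_fold. Qed.

Lemma rounds_le_bigmax rho h i m b :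
  rounds_le rho h m -> eval inp rho h m <= M ->
  (forall j, j < eval inp rho h m -> rounds_le (upd rho i j) h b) ->
  rounds_le rho h (BigMax i m b).
Proof. exact: rounds_le_fold. Qed.

Lemma rounds_le_any rho h i m b :
  rounds_le rho h m -> eval inp rho h m <= M ->
  (forall j, j < eval inp rho h m -> rounds_le (upd rho i j) h b) ->
  rounds_le rho h (Any i m b).
Proof. by move=> rm mM rb; do 2 split=> //; apply: rounds_le_sum. Qed.

Lemma rounds_le_all rho h i m b :
  rounds_le rho h m -> eval inp rho h m <= M ->
  (forall j, j < eval inp rho h m -> rounds_le (upd rho i j) h b) ->
  rounds_le rho h (All i m b).
Proof.
by move=> rm mM rb; split=> //; apply: rounds_le_sum => // j /rb.
Qed.

Lemma rounds_le_min rho h e1 e2 :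
  rounds_le rho h e1 -> rounds_le rho h e2 -> rounds_le rho h (Min e1 e2).
Proof. by []. Qed.

Lemma rounds_le_eqz rho h e : rounds_le rho h e -> rounds_le rho h (Eqz e).
Proof. by []. Qed.

Lemma rounds_le_and rho h e1 e2 :
  rounds_le rho h e1 -> rounds_le rho h e2 -> rounds_le rho h (And e1 e2).
Proof. by []. Qed.

Lemma rounds_le_or rho h e1 e2 :
  rounds_le rho h e1 -> rounds_le rho h e2 -> rounds_le rho h (Or e1 e2).
Proof. by []. Qed.

Lemma rounds_le_leq rho h e1 e2 :
  rounds_le rho h e1 -> rounds_le rho h e2 -> rounds_le rho h (Leq e1 e2).
Proof. by []. Qed.

Lemma rounds_le_times rho h e1 e2 :
  rounds_le rho h e1 -> rounds_le rho h e2 -> eval inp rho h e1 <= M ->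
  rounds_le rho h (Times e1 e2).
Proof.
by move=> r1 r2 e1M; apply: rounds_le_sum => // j _; apply: rounds_le_upd.
Qed.

Lemma rounds_le_pow rho h e m :
  rounds_le rho h e -> rounds_le rho h m ->
  eval inp rho h e <= M -> eval inp rho h m <= M ->
  rounds_le rho h (Pow e m).
Proof.
move=> re rm eM mM; split=> // j a _; apply: rounds_le_times => //.
  by do 2 apply: rounds_le_upd => //.
by rewrite !eval_upd.
Qed.

Lemma rounds_le_div rho h e1 e2 :
  rounds_le rho h e1 -> rounds_le rho h e2 -> eval inp rho h e1 <= M ->
  rounds_le rho h (Div e1 e2).
Proof.
move=> r1 r2 e1M; apply: rounds_le_sum => // j je1; split=> //.
have r1' := rounds_le_upd j (leq_maxl _ (bound e2)) r1.
have r2' := rounds_le_upd j (leq_maxr (bound e1) _) r2.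
split=> //; apply: rounds_le_times => //=.
by rewrite upd_eq addn1; apply: leq_trans e1M.
Qed.

Lemma rounds_le_mod rho h e1 e2 :
  rounds_le rho h e1 -> rounds_le rho h e2 -> eval inp rho h e1 <= M ->
  0 < eval inp rho h e2 -> rounds_le rho h (Mod e1 e2).
Proof.
move=> r1 r2 e1M e20; split=> //; apply: rounds_le_times => //.
  exact: rounds_le_div.
by rewrite eval_div // (leq_trans (leq_div _ _)).
Qed.

Lemma rounds_le_digit rho h b e u :
  rounds_le rho h b -> rounds_le rho h e -> rounds_le rho h u ->
  eval inp rho h b <= M -> eval inp rho h e <= M -> eval inp rho h u <= M ->
  0 < eval inp rho h b -> rounds_le rho h (Digit b e u).
Proof.
move=> rb re ru bM eM uM b0; apply: rounds_le_mod => //.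
  by apply: rounds_le_div => //; apply: rounds_le_pow.
by rewrite eval_div eval_pow ?expn_gt0 ?b0 // (leq_trans (leq_div _ _)).
Qed.

End Rounds.
End Evaluation.

(** * The program *)

Local Notation x_round := 0.
Local Notation x_fuel := 1.
Local Notation x_move := 2.
Local Notation x_vertex := 3.
Local Notation x_dominated := 4.

Definition vertices : expr := Input (Lit 0).
Definition times : expr := Input (Lit 1).
Definition target : expr := Input (Lit 4).

(* The caps by T keep the fuel polynomial in T.  They have no effect in the
   instances for which the dynamic program is run. *)
Definition interval_size : expr := Plus (Min (Input (Lit 3)) times) (Lit 1).
Definition full_fuel : expr :=
  Times (Min (Input (Lit 2)) times) interval_size.
Definition base : expr := Plus full_fuel (Lit 1).
Definition states : expr := Pow base vertices.

Definition fuel_digit : expr := Digit base (Var x_fuel) (Var x_vertex).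
Definition move_digit : expr := Digit base (Var x_move) (Var x_vertex).

Definition legal_expr : expr :=
  All x_vertex vertices
    (And (Leq move_digit (Lit 1))
    (And (Leq move_digit fuel_digit)
         (Or move_digit (Eqz (Mod fuel_digit interval_size))))).

Definition matrix_start : expr :=
  Plus (Lit 5) (Times (Minus times (Plus (Var x_round) (Lit 1)))
                      (Times vertices vertices)).

Definition gain_expr : expr :=
  Sum x_dominated vertices (Any x_vertex vertices
    (And move_digit
         (Or (Input (Plus (Plus matrix_start (Var x_dominated))
                          (Times (Var x_vertex) vertices)))
             (Eq (Var x_vertex) (Var x_dominated))))).

Definition cell (j f : expr) : expr := Plus (Times j states) f.

Definition value_expr : expr :=
  BigMax x_move (Plus (Var x_fuel) (Lit 1))
    (Times legal_expr
       (Plus gain_expr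
             (Entry (cell (Var x_round) (Minus (Var x_fuel) (Var x_move)))))).

Definition saturation : expr := Times vertices (Min full_fuel times).

Definition undecided : expr :=
  And (Leq (Plus saturation (Lit 1)) target)
      (Leq target (Times vertices times)).

Definition dp_cmd : cmd :=
  For x_round (Times undecided times)
    (For x_fuel states
      (Put (cell (Plus (Var x_round) (Lit 1)) (Var x_fuel)) value_expr)).

Definition answer_expr : expr :=
  Or (Leq target saturation)
     (Leq target (Entry (cell times (Minus states (Lit 1))))).

(* p is the input position of the adjacency matrix of the current time. *)
Definition gain (inp : seq nat) (n B p e : nat) : nat :=
  \sum_(v < n) [exists u : 'I_n, (digit B e u != 0) &&
    ((nth 0 inp (p + v + u * n) != 0) || (u == v))].

Local Opaque Fold Pow.

Section Program.

Variable inp : seq nat.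
Implicit Types (rho h : nat -> nat).

Local Notation n := (nth 0 inp 0).
Local Notation T := (nth 0 inp 1).
Local Notation k := (nth 0 inp 2).
Local Notation l := (nth 0 inp 3).
Local Notation t := (nth 0 inp 4).
Local Notation L := (minn l T).+1.
Local Notation K := (minn k T * L).
Local Notation N := (K.+1 ^ n).

Definition input_value : nat -> nat -> nat :=
  value (legal n K.+1 L) (fun i => gain inp n K.+1 (5 + i * (n * n))) T.

Lemma eval_interval_size rho h : eval inp rho h interval_size = L.
Proof. by rewrite /=; lia. Qed.

Lemma eval_full_fuel rho h : eval inp rho h full_fuel = K.
Proof. by rewrite eval_times eval_min eval_interval_size. Qed.

Lemma eval_base rho h : eval inp rho h base = K.+1.
Proof. by rewrite -addn1 -(eval_full_fuel rho h). Qed.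

Lemma eval_states rho h : eval inp rho h states = N.
Proof. by rewrite eval_pow eval_base. Qed.

Lemma eval_base_digit rho h x u :
  eval inp rho h (Digit base (Var x) (Var u)) = digit K.+1 (rho x) (rho u).
Proof. by rewrite eval_digit eval_base. Qed.

Lemma eval_legal rho h :
  eval inp rho h legal_expr = legal n K.+1 L (rho x_fuel) (rho x_move).
Proof.
rewrite eval_all; congr nat_of_bool; apply: eq_forallb => u.
rewrite !eval_and !eval_or eval_eqz eval_mod ?eval_interval_size //.
by rewrite !eval_leq !eval_base_digit !eqb0 !negbK.
Qed.

Lemma eval_gain rho h :
  eval inp rho h gain_expr =
  gain inp n K.+1 (5 + (T - (rho x_round).+1) * (n * n)) (rho x_move).
Proof.
rewrite eval_sum; apply: eq_bigr => v _; rewrite eval_any; congr nat_of_bool.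
apply: eq_existsb => u; rewrite eval_and eval_or eval_base_digit eval_eq.
by rewrite /= !eval_times /= addn1 !eqb0 !negbK.
Qed.

Lemma eval_cell rho h e f :
  eval inp rho h (cell e f) = eval inp rho h e * N + eval inp rho h f.
Proof. by rewrite /= eval_times eval_states. Qed.

Lemma eval_value j f rho h :
  rho x_round = j -> rho x_fuel = f -> j < T ->
  (forall f', f' <= f -> h (j * N + f') = input_value j f') ->
  eval inp rho h value_expr = input_value j.+1 f.
Proof.
move=> rj rf jT row; rewrite eval_bigmax /= rf addn1 [RHS]big_mkcond.
apply: eq_bigr => e _; rewrite eval_times eval_legal /upd /= rf.
case: ifP => _; rewrite ?mul0n ?mul1n //= eval_gain eval_times eval_states.
by rewrite /= rj row ?leq_subr.
Qed.

Lemma sem_row j rho h :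
  rho x_round = j -> j < T ->
  (forall f, f < N -> h (j * N + f) = input_value j f) ->
  forall f, f < N ->
    sem inp rho (For x_fuel states
      (Put (cell (Plus (Var x_round) (Lit 1)) (Var x_fuel)) value_expr)) h
      (j.+1 * N + f) = input_value j.+1 f.
Proof.
move=> rj jT row; rewrite [sem _ _ _ _]/= eval_states; set step := fun _ => _.
suff rows m : m <= N ->
    (forall f, f < N -> iteri m step h (j * N + f) = input_value j f) /\
    (forall f, f < m -> iteri m step h (j.+1 * N + f) = input_value j.+1 f).
  by have [_] := rows N (leqnn _).
elim: m => [|m IH] mN; first by [].
have [old new] := IH (ltnW mN).
rewrite iteriS; set h' := iteri m step h in old new *.
have addrE : eval inp (upd rho x_fuel m) h'
    (cell (Plus (Var x_round) (Lit 1)) (Var x_fuel)) = j.+1 * N + m.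
  by rewrite eval_cell /upd /= rj addn1.
have valueE : eval inp (upd rho x_fuel m) h' value_expr = input_value j.+1 m.
  apply: eval_value => // f' f'm; apply: old; exact: leq_ltn_trans mN.
have -> : step m h' = upd h' (j.+1 * N + m) (input_value j.+1 m).
  by rewrite -addrE -valueE.
split=> f lt_f.
  by rewrite upd_neq ?old //; rewrite mulSn; lia.
rewrite /upd eqn_add2l; case: eqP => [-> //|ne]; apply: new; lia.
Qed.

Lemma eval_undecided rho h :
  eval inp rho h undecided = (n * minn K T < t <= n * T).
Proof.
rewrite eval_and !eval_leq /= !eval_times eval_min eval_full_fuel /= addn1.
by rewrite !eqb0 !negbK.
Qed.

Definition dp_table : nat -> nat := sem inp (fun=> 0) dp_cmd (fun=> 0).

Lemma dp_tableE f : n * minn K T < t <= n * T -> f < N ->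
  dp_table (T * N + f) = input_value T f.
Proof.
move=> und; rewrite /dp_table [sem _ _ _ _]/= eval_times eval_undecided und.
rewrite mul1n /=.
set step := fun _ => _.
suff rows m : m <= T -> forall f, f < N ->
    iteri m step (fun=> 0) (m * N + f) = input_value m f by apply: rows.
elim: m => [//|m IH] mT f' f'N; rewrite iteriS.
by apply: sem_row => //; apply: IH; apply: ltnW.
Qed.

Lemma eval_answer :
  (eval inp (fun=> 0) dp_table answer_expr != 0) =
  (t <= n * minn K T) || (t <= n * T) && (t <= input_value T (N - 1)).
Proof.
rewrite eval_or !eval_leq eval_times eval_min eval_full_fuel /= !eqb0 !negbK.
rewrite eval_times eval_states /=; case: (leqP t (n * minn K T)) => //= qt.
case: (leqP t (n * T)) => tn /=.
  rewrite dp_tableE ?qt ?tn //; last by rewrite subn1 prednK // expn_gt0.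
have -> : dp_table = fun=> 0.
  by rewrite /dp_table /= eval_times eval_undecided (leqNgt t) tn andbF.
by case: (t) qt.
Qed.

Section Rounds.

Variable M : nat.
Hypotheses (nM : n <= M) (TM : T <= M) (KM : K < M).

Local Notation rounds_le := (rounds_le inp M).

Lemma rounds_le_full_fuel rho h : rounds_le rho h full_fuel.
Proof.
by apply: rounds_le_times => //; rewrite eval_min (leq_trans (geq_minr _ _)).
Qed.

Lemma rounds_le_states rho h : rounds_le rho h states.
Proof.
by apply: rounds_le_pow; rewrite ?eval_base //; split=> //;
  apply: rounds_le_full_fuel.
Qed.

Lemma rounds_le_cell rho h e f :
  rounds_le rho h e -> rounds_le rho h f -> eval inp rho h e <= M ->
  rounds_le rho h (cell e f).
Proof.
by move=> re rf eM; split=> //; apply: rounds_le_times => //;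
  apply: rounds_le_states.
Qed.

Lemma rounds_le_base_digit rho h x u :
  rho x <= M -> rho u <= M -> rounds_le rho h (Digit base (Var x) (Var u)).
Proof.
move=> xM uM; apply: rounds_le_digit; rewrite ?eval_base //.
by split=> //; apply: rounds_le_full_fuel.
Qed.

Lemma rounds_le_legal rho h :
  rho x_fuel <= M -> rho x_move <= M -> rounds_le rho h legal_expr.
Proof.
move=> fM eM; apply: rounds_le_all => [//|//|u un].
have uM : u <= M by apply: leq_trans (ltnW un) nM.
have digits x : upd rho x_vertex u x <= M ->
  rounds_le (upd rho x_vertex u) h (Digit base (Var x) (Var x_vertex)).
  by move=> xM; apply: rounds_le_base_digit.
have [re rf] := (digits x_move eM, digits x_fuel fM).
do 2 (apply: rounds_le_and; first exact: rounds_le_leq).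
apply: (rounds_le_or re); apply: rounds_le_eqz; apply: (rounds_le_mod rf) => //.
  by rewrite eval_base_digit (leq_trans _ KM) // ltnW // ltn_pmod.
by rewrite eval_interval_size.
Qed.

Lemma rounds_le_gain rho h : rho x_move <= M -> rounds_le rho h gain_expr.
Proof.
move=> eM; apply: rounds_le_sum => [//|//|v _].
apply: rounds_le_any => [//|//|u un].
have uM : u <= M by apply: leq_trans (ltnW un) nM.
apply: rounds_le_and; first exact: rounds_le_base_digit.
apply: rounds_le_or; last by [].
split; last exact: rounds_le_times.
split; last by [].
split; first by [].
apply: rounds_le_times; [by [] | exact: rounds_le_times |].
by apply: leq_trans TM; rewrite /= leq_subr.
Qed.

Lemma rounds_le_value rho h :
  rho x_round <= M -> rho x_fuel < M -> rounds_le rho h value_expr.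
Proof.
move=> jM fM; have SfM : eval inp rho h (Plus (Var x_fuel) (Lit 1)) <= M.
  by rewrite /= addn1.
apply: rounds_le_bigmax => [//|//|e ef].
have eM : e <= M by apply: leq_trans (ltnW ef) SfM.
apply: rounds_le_times.
- exact: rounds_le_legal (ltnW fM) eM.
- split; first exact: rounds_le_gain.
  suff: rounds_le (upd rho x_move e) h
    (cell (Var x_round) (Minus (Var x_fuel) (Var x_move))) by [].
  exact: rounds_le_cell.
by rewrite eval_legal; apply: leq_trans (leq_b1 _) (leq_ltn_trans _ fM).
Qed.

Lemma rounds_le_saturation rho h : rounds_le rho h saturation.
Proof.
apply: rounds_le_times => //; apply: rounds_le_min => //.
exact: rounds_le_full_fuel.
Qed.

Lemma rounds_le_undecided rho h : rounds_le rho h undecided.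
Proof.
apply: rounds_le_and; apply: rounds_le_leq; [|by []|by []|].
  by split; [apply: rounds_le_saturation |].
exact: rounds_le_times.
Qed.

Lemma sem_rounds_le_dp :
  (n * minn K T < t <= n * T -> N <= M) ->
  sem_rounds_le inp M (fun=> 0) dp_cmd.
Proof.
move=> NM h; split.
- apply: rounds_le_times => //; last first.
    by rewrite eval_undecided; apply: leq_trans (leq_b1 _) (leq_ltn_trans _ KM).
  exact: rounds_le_undecided.
- by rewrite eval_times eval_undecided; case: (_ < _ <= _); rewrite ?mul1n.
move=> j; rewrite eval_times eval_undecided.
case: (_ < _ <= _) NM => [/(_ isT) NM|_]; last by rewrite mul0n.
rewrite mul1n => jT h'.
split; [exact: rounds_le_states | by rewrite eval_states |].
move=> f; rewrite eval_states => fN h''; split.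
  apply: rounds_le_cell; [by [] | by [] |].
  by rewrite /= addn1; apply: leq_trans jT TM.
apply: rounds_le_value; first exact: leq_trans (ltnW jT) TM.
exact: leq_trans fN NM.
Qed.

Lemma rounds_le_answer rho h : rounds_le rho h answer_expr.
Proof.
apply: rounds_le_or; apply: rounds_le_leq; [by [] | | by [] |].
  exact: rounds_le_saturation.
suff: rounds_le rho h (cell times (Minus states (Lit 1))) by [].
apply: rounds_le_cell; [by [] | | exact: TM].
by split; [apply: rounds_le_states |].
Qed.

End Rounds.
End Program.

(** * Correctness *)

Lemma nth_flatten_const (A : Type) (x0 : A) (m : nat) (ss : seq (seq A)) i j :
  all (fun s => size s == m) ss -> j < m -> i < size ss ->
  nth x0 (flatten ss) (i * m + j) = nth x0 (nth [::] ss i) j.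
Proof.
elim: ss i => // s ss IH [|i] /= /andP[/eqP sm h] jm ilt; rewrite nth_cat sm.
  by rewrite jm.
by rewrite mulSn -addnA ltnNge leq_addr /= addKn IH.
Qed.

Section Encoding.

Variables (V : finType) (T : nat) (G : temporal_graph V T) (k l t : nat).
Local Notation n := #|V|.
Local Notation inp := (encode G k l t).
Local Notation K := (k * l.+1).

Lemma nth_encode (i : 'I_T) (u v : V) :
  nth 0 inp (5 + i * (n * n) + enum_rank v + enum_rank u * n) =
  adj (tnth G i) u v.
Proof.
have szV : size (enum V) = n by rewrite -cardE.
have un := ltn_ord (enum_rank u); have vn := ltn_ord (enum_rank v).
have uv : enum_rank v + enum_rank u * n < n * n.
  apply: leq_trans (_ : n + enum_rank u * n <= _); first by rewrite ltn_add2r.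
  by rewrite -mulSn leq_mul2r un orbT.
rewrite -!addnA /encode nth_cat ltnNge leq_addr /= addKn.
rewrite nth_flatten_const ?size_map ?size_tuple //; last first.
  by elim: (val G) => //= g gs ->; rewrite size_allpairs szV eqxx.
rewrite (nth_map (tnth G i)) ?size_tuple // -tnth_nth addnC.
rewrite nth_flatten_const //; first last.
- by rewrite size_map szV.
- by apply/allP => _ /mapP[x _ ->]; rewrite size_map szV.
by rewrite (nth_map u) ?szV // nth_enum_rank (nth_map v) ?szV // nth_enum_rank.
Qed.

Lemma gain_encode (B e : nat) (i : 'I_T) :
  gain inp n B (5 + i * (n * n)) e =
  #|neighbourhood G (fun u _ => digit B e (enum_rank u) != 0) i|.
Proof.
rewrite /gain -sum1dep_card [RHS]big_mkcond /=.
rewrite (reindex (@enum_rank V)) /=; last exact: onW_bij (enum_rank_bij _).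
apply: eq_bigr => v _; rewrite -[RHS]/(nat_of_bool _); congr nat_of_bool.
have entryE u :
    (nth 0 inp (5 + i * (n * n) + enum_rank v + enum_rank u * n) != 0) ||
    (enum_rank u == enum_rank v) = (v \in closed_nbh (tnth G i) u).
  by rewrite nth_encode eqb0 negbK (inj_eq enum_rank_inj) inE eq_sym orbC.
apply/existsP/existsP => -[u]; last by rewrite -entryE; exists (enum_rank u).
by rewrite -(enum_valK u) entryE; exists (enum_val u).
Qed.

Local Notation legal_move := (legal n K.+1 l.+1).
Local Notation gain_at := (fun i => gain inp n K.+1 (5 + i * (n * n))).

Lemma path_of_schedule fuel act : schedule T k l fuel act ->
  is_path legal_move T 0
    (fun i => of_digits K.+1 (fun u : 'I_n => fuel (enum_val u) i))
    (fun i => of_digits K.+1 (fun u : 'I_n => act (enum_val u) i : nat)).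
Proof.
move=> sch i /= iT.
have act_fuel (u : 'I_n) := schedule_act_le (enum_val u) sch iT.
have fuelK (u : 'I_n) := schedule_fuel_le (enum_val u) sch (ltnW iT).
split; last 1 first.
- rewrite -of_digits_sub //; apply: eq_bigr => u _; congr (_ * _).
  by have [run _] := sch (enum_val u); have [_ _] := run i iT.
- apply/legalP => u; rewrite !digit_of_digits // => [|w]; last first.
    by rewrite ltnS; apply: leq_trans (act_fuel w) (fuelK w).
  split=> //; first exact: leq_b1.
  have [run _] := sch (enum_val u); have [_ rest _] := run i iT.
  by case: (act _ i) rest => // rest _; apply: rest.
- exact: leq_of_digits.
Qed.

Lemma schedule_of_path F es :
  is_path legal_move T 0 F es -> F 0 = K.+1 ^ n - 1 ->
  schedule T k l (fun (v : V) i => digit K.+1 (F i) (enum_rank v))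
    (fun v i => digit K.+1 (es i) (enum_rank v) != 0).
Proof.
move=> path F0 v; split; last first.
  by rewrite F0 -(of_digits_max (ltn0Sn K)) digit_of_digits.
have Fb i : i <= T -> F i < K.+1 ^ n.
  elim: i => [|i IH] iT; first by rewrite F0 subn1 prednK // expn_gt0.
  have [_ _ ->] := path i iT.
  exact: leq_ltn_trans (leq_subr _ _) (IH (ltnW iT)).
move=> i iT; have [/(legalP _) lg le_es ->] := path i iT.
have [es1 es_fuel rest] := lg (enum_rank v); split.
- by rewrite -lt0n => act_i; apply: leq_trans es_fuel.
- by rewrite negbK => /eqP.
rewrite (@digit_sub _ _ n) //; [|exact: Fb (ltnW iT)| |].
- by congr (_ - _); case: (digit _ (es i) _) es1 => [|[]].
- exact: leq_ltn_trans le_es (Fb _ (ltnW iT)).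
by move=> w; have [] := lg w.
Qed.

Lemma leq_valueP :
  reflect (exists fuel act, schedule T k l fuel act /\ t <= coverage G act)
          (t <= value legal_move gain_at T T (K.+1 ^ n - 1)).
Proof.
apply: (iffP idP) => [tv|[fuel [act [sch tc]]]].
  have Sb : K.+1 ^ n - 1 < K.+1 ^ n by rewrite subn1 prednK // expn_gt0.
  have [F [es]] :=
    value_path gain_at (legal_exists (ltn0Sn K) l.+1 (n := n)) (leqnn T) Sb.
  rewrite subnn => -[F0 path valueE]; have sch := schedule_of_path path F0.
  do 2 eexists; split; first exact: sch.
  rewrite valueE big_mkord in tv; apply: leq_trans tv _.
  by apply: leq_sum => i _; rewrite gain_encode.
have start :
    of_digits K.+1 (fun u : 'I_n => fuel (enum_val u) 0) = K.+1 ^ n - 1.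
  rewrite -(of_digits_max (ltn0Sn K)).
  by apply: eq_bigr => u _; have [_ ->] := sch (enum_val u).
apply: leq_trans tc _; rewrite -start.
apply: leq_trans (path_le_value gain_at (path_of_schedule sch)).
rewrite big_mkord; apply: leq_sum => i _; rewrite gain_encode.
apply: subset_leq_card; apply/subsetP => v; rewrite !inE.
case/existsP => u /andP[act_u vu]; apply/existsP; exists u; rewrite vu andbT.
rewrite digit_of_digits ?enum_rankK ?act_u // => w.
apply: leq_ltn_trans (schedule_act_le _ sch (ltn_ord i)) _.
by rewrite ltnS (schedule_fuel_le _ sch (ltnW (ltn_ord i))).
Qed.

End Encoding.

Lemma fuel_lt_times n K T t : n * minn K T < t <= n * T -> K < T.
Proof.
case/andP=> lt_t le_t; rewrite ltnNge; apply/negP => /minn_idPr TK.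
by rewrite TK ltnNge le_t in lt_t.
Qed.

Lemma decide_input_correct (V : finType) (T : nat) (G : temporal_graph V T)
    (k l t : nat) (inp := encode G k l t) :
  1 <= k ->
  (eval inp (fun=> 0) (dp_table inp) answer_expr != 0) =
  timeline_partial_dominating_set G k l t.
Proof.
move=> k0; rewrite eval_answer.
rewrite -[nth 0 inp 0]/#|V| -[nth 0 inp 1]/T -[nth 0 inp 2]/k.
rewrite -[nth 0 inp 3]/l -[nth 0 inp 4]/t.
case: leqP => [tq|qt] /=.
  apply/esym.
  apply: (timeline_partial_dominating_setW (geq_minl k T) (geq_minl l T)).
  exact: saturated_yes.
case: leqP => [tn|nt] /=; last by rewrite oversized_no.
have KT := fuel_lt_times (introT andP (conj qt tn)).
have kT : minn k T = k by nia.
have lT : minn l T = l by nia.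
rewrite /input_value kT lT.
exact: sameP (leq_valueP G k l t) (timeline_partial_dominating_setP G k l t).
Qed.

(** * Running time *)

Lemma leq_expS_exp2 n K t : n * K <= t -> K.+1 ^ n <= 2 ^ t.
Proof.
move=> nKt; apply: leq_trans (_ : 2 ^ (n * K) <= _); last by rewrite leq_exp2l.
by rewrite mulnC expnM; case: n {nKt} => // n; rewrite leq_exp2r // ltn_expl.
Qed.

Lemma decide_input_cost : exists W, forall inp : seq nat,
  sem_cost inp (fun=> 0) dp_cmd (fun=> 0) +
    eval_cost inp (fun=> 0) (dp_table inp) answer_expr <=
  poly_bound W ((nth 0 inp 0 + nth 0 inp 1 + 1) ^ 2 * 2 ^ nth 0 inp 4).
Proof.
exists (cmd_weight dp_cmd + weight answer_expr) => inp.
set n := nth 0 inp 0; set T := nth 0 inp 1; set t := nth 0 inp 4.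
set L := (minn (nth 0 inp 3) T).+1; pose K := minn (nth 0 inp 2) T * L.
set N2 := (n + T + 1) ^ 2.
have N2_ge : [/\ n <= N2, T <= N2 & K < N2].
  have kT : minn (nth 0 inp 2) T <= T by apply: geq_minr.
  have lT : L <= T.+1 by apply: geq_minr.
  by rewrite /N2 -mulnn /K; split; nia.
have [nN TN KN] := N2_ge.
have N2_le x : x <= N2 -> x <= N2 * 2 ^ t.
  by move=> xN; apply: leq_trans xN _; rewrite leq_pmulr // expn_gt0.
apply: leq_poly_bound_add.
- apply: sem_cost_le.
  apply: sem_rounds_le_dp => [|||und]; [exact: N2_le..|].
  have /minn_idPl KT : K <= T by apply: ltnW; apply: fuel_lt_times und.
  have nKt : n * K <= t by case/andP: und; rewrite KT => /ltnW.
  apply: leq_trans (leq_expS_exp2 nKt) _; rewrite leq_pmull //.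
  exact: leq_ltn_trans (leq0n _) KN.
- by apply: eval_cost_le; apply: rounds_le_answer; apply: N2_le.
Qed.

Definition time_exponent (W : nat) : nat := W * 2 ^ W + 2 * W + 2.

Lemma leq_time_exponent W N t x :
  0 < N -> x <= poly_bound W (N ^ 2 * 2 ^ t) ->
  x + 2 <= time_exponent W * 2 ^ (time_exponent W * t) * N ^ time_exponent W.
Proof.
move=> N0 xW; set c := time_exponent W; pose X := 2 ^ (W * t) * N ^ (2 * W).
have cE : c = W * 2 ^ W + 2 * W + 2 by [].
have X0 : 0 < X by rewrite muln_gt0 !expn_gt0 N0.
have XE : (2 * (N ^ 2 * 2 ^ t)) ^ W = 2 ^ W * X.
  by rewrite (expnMn 2) (expnMn (N ^ 2)) -!expnM [N ^ _ * _]mulnC [t * W]mulnC.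
have xX : x <= W * 2 ^ W * X.
  apply: leq_trans xW _; rewrite -mulnA -XE leq_mul2l; apply/orP; right.
  have M0 : 0 < N ^ 2 * 2 ^ t by rewrite muln_gt0 !expn_gt0 N0.
  by case: (W) => // w; rewrite leq_exp2r // mul2n -addnn -addn1 leq_add2l.
apply: leq_trans (_ : (W * 2 ^ W + 2) * X <= _).
  by rewrite mulnDl leq_add // leq_pmulr.
rewrite -mulnA; apply: leq_mul; first by lia.
by apply: leq_mul; rewrite leq_pexp2l // ?leq_mul2r; lia.
Qed.

Theorem theorem5p5 :
  exists (P : program) (c : nat),
    forall (V : finType) (T : nat) (G : temporal_graph V T) (k l t : nat),
      1 <= k ->
      answers_within P (encode G k l t)
        (c * 2 ^ (c * t) * (#|V| + T + 1) ^ c)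
        (timeline_partial_dominating_set G k l t).
Proof.
have [W cost_le] := decide_input_cost.
exists (compile dp_cmd answer_expr), (time_exponent W) => V T G k l t k0.
rewrite -decide_input_correct //; apply: exec_compile.
by apply: leq_time_exponent (cost_le _); rewrite addn1.
Qed.
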